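(* Let $k$ be an algebraically closed field. Let $\mathbf{a}=(a_1,a_2,a_3)\in\mathbb{Z}_{\geq 1}^3$, put $t=a_1+a_2+a_3$, and let $\mathbf{d}=(d_1,\dots,d_t)\in\mathbb{Z}_{\geq 1}^t$ be a dimension vector with $n=\sum_{i=1}^t d_i$. Let $P(\mathbf{d})\subseteq \mathrm{GL}_n(k)$ and $\mathfrak{q}_u(\mathbf{a},\mathbf{d})$ be as defined in the context; $P(\mathbf{d})$ acts on $\mathfrak{q}_u(\mathbf{a},\mathbf{d})$ by the adjoint action (conjugation). (1) Suppose $(\mathbf{a},\mathbf{d})$ is one of the following six pairs (''Table 1''): - $\mathbf{a}=(1,3,5)$, $\mathbf{d}=(3,2,2,2,1,1,1,1,1)$; - $\mathbf{a}=(1,4,3)$, $\mathbf{d}=(2,1,1,1,1,1,1,1)$; - $\mathbf{a}=(1,6,2)$, $\mathbf{d}=(3,1,1,1,1,1,1,2,2)$; - $\mathbf{a}=(2,2,5)$, $\mathbf{d}=(2,2,3,3,1,1,1,1,1)$; - $\mathbf{a}=(2,3,2)$, $\mathbf{d}=(1,1,1,1,1,1,1)$; - $\mathbf{a}=(3,2,3)$, $\mathbf{d}=(1,1,1,2,2,1,1,1)$. Then $P(\mathbf{d})$ acts on $\mathfrak{q}_u(\mathbf{a},\mathbf{d})$ with infinitely many orbits. (2) Suppose $\mathbf{a}$ is one of the following triples (''Table 2''): $(1,2,m)$ for some $m\in\mathbb{Z}_{\geq1}$; $(1,m,1)$ for some $m\in\mathbb{Z}_{\geq1}$; $(m,1,l)$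 for some $m,l\in\mathbb{Z}_{\geq1}$; $(1,3,4)$; $(1,5,2)$; $(2,2,4)$. Then for every dimension vector $\mathbf{d}\in\mathbb{Z}_{\geq1}^t$, $P(\mathbf{d})$ acts on $\mathfrak{q}_u(\mathbf{a},\mathbf{d})$ with finitely many orbits. (3) Every triple $\mathbf{a}\in\mathbb{Z}_{\geq1}^3$ either satisfies $\mathbf{a}\leq \mathbf{c}$ or $\mathbf{a}\leq\mathbf{c}_{\mathrm{rev}}$ for some triple $\mathbf{c}$ in Table 2, or satisfies $\mathbf{a}\geq\mathbf{c}$ or $\mathbf{a}\geq\mathbf{c}_{\mathrm{rev}}$ for some triple $\mathbf{c}$ occurring in Table 1 (as the first entry of a pair). In the former case $P(\mathbf{d})$ has finitely many orbits on $\mathfrak{q}_u(\mathbf{a},\mathbf{d})$ for all dimension vectors $\mathbf{d}$; in the latter case $P(\mathbf{d})$ has infinitely many orbits on $\mathfrak{q}_u(\mathbf{a},\mathbf{d})$ for some dimension vector $\mathbf{d}$.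
   Context: For a dimension vector $\mathbf{d}=(d_1,\dots,d_t)\in\mathbb{Z}_{\geq1}^t$ with $\sum_i d_i=n$, set $e_i=\sum_{j=1}^i d_j$ ($e_0=0$). $P(\mathbf{d})$ is the parabolic subgroup of $\mathrm{GL}_n(k)$ stabilizing the standard flag $0\subseteq k^{e_1}\subseteq k^{e_2}\subseteq\dots\subseteq k^{e_t}=k^n$ (where $k^{e_i}$ is spanned by the first $e_i$ standard basis vectors), i.e. the block upper-triangular invertible matrices with $(i,j)$ block of size $d_i\times d_j$. For $\mathbf{a}=(a_1,a_2,a_3)$ with $a_1+a_2+a_3=t$, set $b_i=\sum_{j=1}^i a_j$ for $i=0,1,2,3$, and let $Q(\mathbf{a},\mathbf{d})=P(e_{b_1},\,e_{b_2}-e_{b_1},\,e_{b_3}-e_{b_2})\supseteq P(\mathbf{d})$ (a parabolic subgroup with three diagonal blocks). $\mathfrak{q}_u(\mathbf{a},\mathbf{d})$ denotes the Lie algebra of the unipotent radical of $Q(\mathbf{a},\mathbf{d})$, i.e. the block strictly upper-triangular $n\times n$ matrices with respect to the block sizes $e_{b_1},\,e_{b_2}-e_{b_1},\,e_{b_3}-e_{b_2}$. The partial order on triples is $\mathbf{a}\leq\tilde{\mathbf{a}}$ iff $a_i\leq\tilde a_i$ for $i=1,2,3$. The reverse of $\mathbf{a}=(a_1,a_2,a_3)$ is $\mathbf{a}_{\mathrm{rev}}=(a_3,a_2,a_1)$. *)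

(* Defs.v *)
From HB Require Import structures.
From mathcomp Require Import all_boot all_order all_algebra.
Set Implicit Arguments. Unset Strict Implicit. Unset Printing Implicit Defensive.
Import GRing.Theory.
Local Open Scope ring_scope.

Definition tr1 (a : nat * nat * nat) : nat := a.1.1.
Definition tr2 (a : nat * nat * nat) : nat := a.1.2.
Definition tr3 (a : nat * nat * nat) : nat := a.2.

Definition pos_triple (a : nat * nat * nat) : Prop :=
  (1 <= tr1 a)%N /\ (1 <= tr2 a)%N /\ (1 <= tr3 a)%N.

Definition le_triple (a c : nat * nat * nat) : Prop :=
  (tr1 a <= tr1 c)%N /\ (tr2 a <= tr2 c)%N /\ (tr3 a <= tr3 c)%N.

Definition rev_triple (a : nat * nat * nat) : nat * nat * nat :=
  (tr3 a, tr2 a, tr1 a).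

Definition dimvec (a : nat * nat * nat) (d : seq nat) : Prop :=
  size d = (tr1 a + tr2 a + tr3 a)%N /\ all (fun x => 0 < x)%N d.

Definition esum (d : seq nat) (m : nat) : nat := sumn (take m d).

(* 0-based index of the block of d containing the 0-based row/column i:
   number of j in 1..t with e_j <= i *)
Definition blk (d : seq nat) (i : nat) : nat :=
  count (fun j => esum d j.+1 <= i)%N (iota 0 (size d)).

(* 0-based coarse block index w.r.t. sizes e_{b1}, e_{b2}-e_{b1}, e_{b3}-e_{b2} *)
Definition cblk (a : nat * nat * nat) (d : seq nat) (i : nat) : nat :=
  ((esum d (tr1 a) <= i)%N + (esum d (tr1 a + tr2 a) <= i)%N)%N.

Definition inP (k : fieldType) (d : seq nat) (g : 'M[k]_(sumn d)) : Prop :=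
  g \in unitmx /\
  forall i j : 'I_(sumn d), (blk d j < blk d i)%N -> g i j = 0.

Definition inQu (k : fieldType) (a : nat * nat * nat) (d : seq nat)
    (X : 'M[k]_(sumn d)) : Prop :=
  forall i j : 'I_(sumn d), ~~ (cblk a d i < cblk a d j)%N -> X i j = 0.

Definition same_orbit (k : fieldType) (d : seq nat) (X Y : 'M[k]_(sumn d)) : Prop :=
  exists g, inP g /\ X = g *m Y *m invmx g.

Definition finitely_many_orbits (k : fieldType) (a : nat * nat * nat) (d : seq nat) : Prop :=
  exists s : seq 'M[k]_(sumn d),
    (forall Y, Y \in s -> inQu a Y) /\
    forall X, inQu a X -> exists2 Y, Y \in s & same_orbit X Y.

Definition table1 : seq ((nat * nat * nat) * seq nat) :=
  [:: ((1,3,5), [:: 3;2;2;2;1;1;1;1;1]);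
      ((1,4,3), [:: 2;1;1;1;1;1;1;1]);
      ((1,6,2), [:: 3;1;1;1;1;1;1;2;2]);
      ((2,2,5), [:: 2;2;3;3;1;1;1;1;1]);
      ((2,3,2), [:: 1;1;1;1;1;1;1]);
      ((3,2,3), [:: 1;1;1;2;2;1;1;1])]%N.

Definition in_table2 (c : nat * nat * nat) : Prop :=
  (exists m, (1 <= m)%N /\ c = (1,2,m)%N) \/
  (exists m, (1 <= m)%N /\ c = (1,m,1)%N) \/
  (exists m l, (1 <= m)%N /\ (1 <= l)%N /\ c = (m,1,l)%N) \/
  c = (1,3,4)%N \/ c = (1,5,2)%N \/ c = (2,2,4)%N.

(* Main.v *)
(* Idea: Write an element of [q_u] in block form as maps [A : W2 -> W1], [B : W3 -> W1],
   [C : W3 -> W2] between flagged spaces.  The orbit is determined by two independent pieces of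
   data.  The first is the space [W2] with three chains of subspaces: its own flag, the images
   under [C] of the flag of [W3], and the preimages under [A] of the flag of [W1].  The second is
   the map [ker C -> coker A] induced by [B], which again amounts to chains of subspaces of a
   flagged complement of [im A].  A space with three chains of lengths [p0, p1, p2] is a
   representation of a star quiver, of finite type iff [1/p0 + 1/p1 + 1/p2 > 1]; here the lengths
   are [a2, a3 + 1, a1 + 1].

   Finiteness is a reflection functor argument.  If every pair of the top proper subspaces of
   the three chains spans the space, then the Coxeter functor loses no information; otherwise a
   line splits off.  The Coxeter functor preserves the Tits form, hence keeps dimensions bounded,
   while a second linear quantity drops by at least a fixed amount at every step.  So the process
   stops, and indecomposable systems with the same dimensions are isomorphic.

   In the six critical cases the star quiver is of type E6~, E7~ or E8~ and a one-parameter
   family is written down.  Adding blocks preserves such families, because the compression of an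
   invertible block triangular matrix to a union of blocks is invertible; transposition along the
   antidiagonal handles reversed triples. *)
From HB Require Import structures.
Require Import Defs.
From mathcomp Require Import all_boot all_order all_algebra.
From mathcomp Require Import zify ring lra.
From Stdlib Require Import Classical.
Set Implicit Arguments. Unset Strict Implicit. Unset Printing Implicit Defensive.
Import Order.TTheory GRing.Theory Num.Theory.
Local Open Scope ring_scope.

(** The images of the flag of [W3] need not exhaust [W2], and the preimages of the flag of [W1]
    begin with [ker A] instead of 0: each chain gains one term, which explains the lengths [a3 + 1]
    and [a1 + 1]. The second datum is a system with chains of lengths [a1], [a3 + 1] and 1; its sum
    of reciprocals always exceeds 1, so the first system alone decides finiteness.

    The linear quantity is modelled on the defect of tame quivers: when the sum of reciprocals is
    exactly 1 it is invariant under the Coxeter functor, and above 1 it drifts in one direction. The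
    Tits form dominates a positive multiple of the square of the dimension, so its invariance
    confines the dimension, and the drift cannot go on forever.

    The dimension vectors of the six critical pairs give the three chains the dimensions of the
    minimal positive radical vector of the Tits form: [W2] has dimension 3, 4 or 6 for E6~, E7~ or
    E8~. *)

(** * Linear maps between subspaces *)
Section LinearMaps.
Variable k : fieldType.
Implicit Types vT wT : vectType k.

Lemma lfun_glue vT wT (f g : 'Hom(vT, wT)) (X Y : {vspace vT}) :
  (X :&: Y = 0)%VS -> exists h : 'Hom(vT, wT), {in X, h =1 f} /\ {in Y, h =1 g}.
Proof.
move=> dXY; have dYX : (Y :&: X = 0)%VS by rewrite capvC.
exists ((f \o daddv_pi X Y) + (g \o daddv_pi Y X))%VF; split=> v vX.
- have vXY := subvP (addvSl X Y) _ vX.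
  have := daddv_pi_add dXY vXY; rewrite daddv_pi_id // => e.
  have /eqP e0 : daddv_pi Y X v == 0 by rewrite -(inj_eq (addrI v)) e addr0.
  by rewrite add_lfunE !comp_lfunE daddv_pi_id // e0 linear0 addr0.
- have vYX := subvP (addvSl Y X) _ vX.
  have := daddv_pi_add dYX vYX; rewrite (daddv_pi_id dYX vX) => e.
  have /eqP e0 : daddv_pi X Y v == 0 by rewrite -(inj_eq (addrI v)) e addr0.
  by rewrite add_lfunE !comp_lfunE (daddv_pi_id dYX vX) e0 linear0 add0r.
Qed.

Lemma lfun_section vT wT (f : 'Hom(vT, wT)) (V : {vspace vT}) :
  {s : 'Hom(wT, vT) | (forall w, s w \in V) /\ {in (f @: V)%VS, forall w, f (s w) = w}}.
Proof.
pose h := (f \o projv V)%VF.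
exists (projv V \o h^-1)%VF; split=> [w|w wf]; first by rewrite comp_lfunE memv_proj.
rewrite comp_lfunE -comp_lfunE limg_lfunVK //.
by rewrite /h limg_comp limg_proj.
Qed.

Lemma vspace_iso vT wT (X : {vspace vT}) (Y : {vspace wT}) :
  \dim X = \dim Y ->
  exists h : 'Hom(vT, wT), (h @: X = Y)%VS /\ {in X, forall v, h v = 0 -> v = 0}.
Proof.
move=> dXY.
have [f fE] : {f : 'Hom(vT, wT) | map f (vbasis X) = vbasis Y}.
  have [f /(_ (basis_free (vbasisP X)))] := linear_of_free (vbasis X) (vbasis Y).
  rewrite !size_tuple => /(_ (esym dXY)) fE.
  by exists (linfun f); rewrite -fE; apply: eq_map => x; rewrite lfunE.
have fX : (f @: X = Y)%VS.
  by rewrite -(span_basis (vbasisP X)) limg_span fE (span_basis (vbasisP Y)).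
exists f; split=> // v vX fv0.
have := limg_ker_dim f X; rewrite fX -dXY => /eqP.
rewrite -[X in _ == X]add0n eqn_add2r dimv_eq0 => /eqP e.
by apply/eqP; rewrite -memv0 -e memv_cap vX memv_ker fv0 eqxx.
Qed.

Lemma dim_limg_inj vT wT (f : 'Hom(vT, wT)) (X : {vspace vT}) :
  {in X, forall v, f v = 0 -> v = 0} -> \dim (f @: X) = \dim X.
Proof.
move=> fI; apply: limg_dim_eq; apply/eqP; rewrite -subv0; apply/subvP=> v.
by rewrite memv_cap memv_ker memv0 => /andP[vX /eqP/(fI v vX)->].
Qed.

Lemma lfun_inj_dim vT wT (f : 'Hom(vT, wT)) (X : {vspace vT}) :
  (\dim X <= \dim (f @: X))%N -> {in X, forall v, f v = 0 -> v = 0}.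
Proof.
move=> dX v vX fv0; have := limg_ker_dim f X => e.
have : (\dim (X :&: lker f) <= 0)%N by rewrite -(leq_add2r (\dim (f @: X))) e.
rewrite leqn0 dimv_eq0 => /eqP e0.
by apply/eqP; rewrite -memv0 -e0 memv_cap vX memv_ker fv0 eqxx.
Qed.

Lemma vcomplement vT (X V : {vspace vT}) : (X <= V)%VS ->
  exists D : {vspace vT}, (X + D = V)%VS /\ (X :&: D = 0)%VS.
Proof.
move=> XV; exists (V :\: X)%VS; split; last by rewrite capvC capv_diff.
by rewrite addvC addv_diff; apply/addv_idPl.
Qed.

Lemma capv0P vT (X Y : {vspace vT}) :
  (forall v, v \in X -> v \in Y -> v = 0) <-> (X :&: Y = 0)%VS.
Proof.
split=> [h|h v vX vY].
  by apply/eqP; rewrite -subv0; apply/subvP=> v /memv_capP[vX vY]; rewrite memv0 (h v).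
by apply/eqP; rewrite -memv0 -h memv_cap vX.
Qed.

End LinearMaps.

(** * Chains of subspaces *)
Section Filtrations.
Variable k : fieldType.
Implicit Types vT wT : vectType k.

Definition chain vT (F : nat -> {vspace vT}) :=
  F 0%N = 0%VS /\ forall j, (F j <= F j.+1)%VS.

Lemma chainS vT (F : nat -> {vspace vT}) i j : chain F -> (i <= j)%N -> (F i <= F j)%VS.
Proof.
move=> [_ FS] /subnK <-; elim: (j - i)%N => [|m IH]; first by rewrite add0n subvv.
exact: subv_trans IH (FS _).
Qed.

Lemma capv_chain vT (F : nat -> {vspace vT}) (Z : {vspace vT}) :
  chain F -> chain (fun j => F j :&: Z)%VS.
Proof. by move=> [F0 FS]; split=> [|j]; rewrite ?F0 ?cap0v // capvS. Qed.

Lemma lfun_inj_limg vT (g : 'End(vT)) (X : {vspace vT}) :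
  {in X, forall v, g v \in X} -> {in X, forall v, g v = 0 -> v = 0} -> (g @: X = X)%VS.
Proof.
move=> gX gI; apply/eqP; rewrite eqEdim dim_limg_inj // leqnn andbT.
by apply/subvP=> _ /memv_imgP[v vX ->]; apply: gX.
Qed.

(** An arbitrary complement of [K] ignores the chain, so [T] grows along it: each step adds a
    complement of [F m + F m.+1 :&: K] in [F m.+1]. *)
Lemma chain_complement vT (F : nat -> {vspace vT}) (K : {vspace vT}) m : chain F ->
  exists T : {vspace vT}, [/\ (T <= F m)%VS, (K :&: T = 0)%VS &
    forall i, (i <= m)%N -> (F i <= F i :&: K + F i :&: T)%VS].
Proof.
move=> cF; elim: m => [|m [T [TF KT FT]]].
  exists 0%VS; split; [exact: sub0v|exact: capv0|].
  by case=> // _; rewrite cF.1 sub0v.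
have [D [RD dRD]] : exists D, ((F m + F m.+1 :&: K) + D = F m.+1)%VS
    /\ ((F m + F m.+1 :&: K) :&: D = 0)%VS.
  by apply: vcomplement; rewrite subv_add cF.2 capvSl.
exists (T + D)%VS; split.
- by rewrite subv_add (subv_trans TF (cF.2 m)) -RD addvSr.
- apply/capv0P=> v vK /memv_addP[t tT [d dD e]].
  have tF : t \in F m := subvP TF _ tT.
  have dF : d \in F m.+1 by rewrite -RD (subvP (addvSr _ _)).
  have vF : v \in F m.+1 by rewrite e memvD // (subvP (cF.2 m)).
  have d0 : d = 0.
    apply: ((capv0P _ _).2 dRD _ _ dD).
    have -> : d = - t + v by rewrite e addKr.
    by rewrite memv_add ?memvN // memv_cap vF.
  move: e; rewrite d0 addr0 => e; rewrite e in vK *.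
  exact: (capv0P _ _).2 KT _ vK tT.
move=> i; rewrite leq_eqVlt => /orP[/eqP ->|]; last first.
  rewrite ltnS => /FT Fi; apply: subv_trans Fi _.
  by rewrite addvS // capvS // addvSl.
rewrite -{1}RD !subv_add addvSl andbT; apply/andP; split; last first.
  apply: subv_trans (addvSr _ _); rewrite subv_cap addvSr andbT.
  by rewrite -RD addvSr.
apply: subv_trans (FT m (leqnn m)) _; apply: addvS.
  exact: capvS (cF.2 m) (subvv _).
by apply: capvS (cF.2 m) (addvSl _ _).
Qed.

(** Image chains classify maps out of a flagged space, up to automorphisms of the flag. In passing
    from [F m] to [F m.+1], new kernel vectors [E] go to new kernel vectors [E'], equally many by
    rank-nullity, and the remaining directions [D] are lifted through [C']. *)
Lemma chain_lift vT wT (F : nat -> {vspace vT}) (C C' : 'Hom(vT, wT)) m : chain F ->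
    (forall i, (i <= m)%N -> (C @: F i = C' @: F i)%VS) ->
  exists g : 'End(vT), [/\ forall i, (i <= m)%N -> (g @: F i = F i)%VS,
    {in F m, forall v, g v = 0 -> v = 0} & {in F m, forall v, C' (g v) = C v}].
Proof.
move=> cF; elim: m => [|m IH] CC'.
  exists \1%VF; split.
  - by move=> i; rewrite lim1g.
  - by move=> v _; rewrite id_lfunE.
  - by move=> v; rewrite cF.1 memv0 => /eqP ->; rewrite !linear0.
have [i im|g [gF gI gC]] := IH; first by apply: CC'; apply: leqW.
have FS := cF.2 m; have FSP := subvP FS.
have gFm v : v \in F m -> g v \in F m by move=> vF; rewrite -(gF m) ?memv_img.
have [E [KE dKE]] := vcomplement (capvS FS (subvv (lker C))).
have [E' [KE' dKE']] := vcomplement (capvS FS (subvv (lker C'))).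
have dE : \dim E = \dim E'.
  have h (f : 'Hom(vT, wT)) i := limg_ker_dim f (F i).
  have d1 : \dim (F m :&: lker C) = \dim (F m :&: lker C').
    by apply/eqP; rewrite -(eqn_add2r (\dim (C @: F m))) h CC' // h.
  have d2 : \dim (F m.+1 :&: lker C) = \dim (F m.+1 :&: lker C').
    by apply/eqP; rewrite -(eqn_add2r (\dim (C @: F m.+1))) h CC' // h.
  apply/eqP; rewrite -(eqn_add2l (\dim (F m :&: lker C))) -dimv_disjoint_sum // KE d2.
  by rewrite d1 -dimv_disjoint_sum // KE'.
have [eta [etaE etaI]] := vspace_iso dE.
have EF v : v \in E -> v \in F m.+1 /\ C v = 0.
  move=> vE; have : v \in (F m.+1 :&: lker C)%VS by rewrite -KE (subvP (addvSr _ _)).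
  by rewrite memv_cap memv_ker => /andP[-> /eqP].
have EF' v : v \in E' -> v \in F m.+1 /\ C' v = 0.
  move=> vE; have : v \in (F m.+1 :&: lker C')%VS by rewrite -KE' (subvP (addvSr _ _)).
  by rewrite memv_cap memv_ker => /andP[-> /eqP].
have FE0 : (F m :&: E = 0)%VS.
  apply/capv0P=> v vF vE; apply: ((capv0P _ _).2 dKE _ _ vE).
  by rewrite memv_cap vF memv_ker (EF _ vE).2 eqxx.
have [D [FD dFD]] : exists D, ((F m + E) + D = F m.+1)%VS /\ ((F m + E) :&: D = 0)%VS.
  by apply: vcomplement; rewrite subv_add FS; apply/subvP=> v /EF[].
have [s [sF sC]] := lfun_section C' (F m.+1).
have [h1 [h1F h1E]] := lfun_glue g eta FE0.
have [h [hFE hD]] := lfun_glue h1 (s \o C)%VF dFD.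
have hF v : v \in F m -> h v = g v.
  by move=> vF; rewrite hFE ?h1F // (subvP (addvSl _ _)).
have hE v : v \in E -> h v = eta v.
  by move=> vF; rewrite hFE ?h1E // (subvP (addvSr _ _)).
have etaE' v : v \in E -> eta v \in E' by move=> vE; rewrite -etaE memv_img.
have DF v : v \in D -> v \in F m.+1 by move=> vD; rewrite -FD (subvP (addvSr _ _)).
have CsD d : d \in D -> C' (s (C d)) = C d.
  by move=> dD; rewrite sC // -CC' // memv_img // DF.
have decomp v : v \in F m.+1 -> exists f e d, [/\ f \in F m, e \in E, d \in D & v = f + e + d].
  by rewrite -FD => /memv_addP[_ /memv_addP[f fF [e eE ->]] [d dD ->]]; exists f, e, d.
have hC : {in F m.+1, forall v, C' (h v) = C v}.
  move=> v /decomp[f [e [d [fF eE dD ->]]]].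
  rewrite !linearD /= hF // hE // hD // comp_lfunE gC //.
  by rewrite (EF' _ (etaE' _ eE)).2 (EF _ eE).2 CsD.
have hI : {in F m.+1, forall v, h v = 0 -> v = 0}.
  move=> v /decomp[f [e [d [fF eE dD ->]]]] hv0.
  (* If [h v = 0] then [C d] lies in [C @: F m], so [d] is a kernel vector modulo [F m]; hence it
     lies in [F m + E], which meets [D] trivially. *)
  have d0 : d = 0.
    apply: ((capv0P _ _).2 dFD _ _ dD).
    have Cd : C d \in (C' @: F m)%VS.
      have -> : C d = - C f.
        have fed : f + e + d \in F m.+1.
          by rewrite !memvD // ?(EF _ eE).1 // ?(DF _ dD) // (FSP _ fF).
        have := hC _ fed; rewrite hv0 linear0 !linearD /= (EF _ eE).2 addr0.
        by move=> /esym/eqP; rewrite addrC addr_eq0 => /eqP.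
      by rewrite memvN -CC' // memv_img.
    move: Cd; rewrite -CC' // => /memv_imgP[f' f'F Cf'].
    have -> : d = f' + (d - f') by rewrite addrC subrK.
    have : d - f' \in (F m.+1 :&: lker C)%VS.
      by rewrite memv_cap memv_ker linearB /= Cf' subrr eqxx memvB ?(DF _ dD) ?(FSP _ f'F).
    rewrite -KE => /memv_addP[f2 /memv_capP[f2F _] [e2 e2E ->]].
    by rewrite addrA memv_add // memvD.
  move: hv0; rewrite d0 addr0 linearD /= hF // hE // => hv0.
  have e0 : e = 0.
    apply: etaI => //; apply: ((capv0P _ _).2 dKE' _ _ (etaE' _ eE)).
    have /eqP := congr1 C' hv0.
    rewrite linearD linear0 /= (EF' _ (etaE' _ eE)).2 addr0 => C'gf.
    have /eqP := hv0; rewrite addrC addr_eq0 => /eqP ->.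
    by rewrite memvN memv_cap gFm // memv_ker.
  by move: hv0; rewrite e0 !linear0 !addr0 => /gI ->.
exists h; split=> // i; rewrite leq_eqVlt => /orP[/eqP ->|].
  apply: lfun_inj_limg => // v /decomp[f [e [d [fF eE dD ->]]]].
  rewrite !linearD /= hF // hE // hD // comp_lfunE.
  by rewrite !memvD ?sF ?(FSP _ (gFm _ fF)) ?(EF' _ (etaE' _ eE)).1.
rewrite ltnS => im; rewrite -{2}(gF i im); apply: eq_in_limg => v vF.
by rewrite hF // (subvP (chainS cF im)).
Qed.

(** Dual to [chain_lift]: preimage chains classify maps into a flagged space. The new part [T] of
    the preimage prescribes [A t] to [A' t]; both images are independent of [F m] because the
    preimages of [F m] agree. The remaining complements [D] and [D'] are matched by dimension. *)
Lemma chain_extend uT vT (F : nat -> {vspace vT}) (W : {vspace uT}) (A A' : 'Hom(uT, vT)) m :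
    chain F -> (forall i, (i <= m)%N -> W :&: A @^-1: F i = W :&: A' @^-1: F i)%VS ->
  exists g : 'End(vT), [/\ forall i, (i <= m)%N -> (g @: F i = F i)%VS,
    {in F m, forall v, g v = 0 -> v = 0} &
    {in W, forall w, A w \in F m -> g (A w) = A' w}].
Proof.
move=> cF; elim: m => [|m IH] AA'.
  exists \1%VF; split.
  - by move=> i; rewrite lim1g.
  - by move=> v _; rewrite id_lfunE.
  move=> w wW Aw; rewrite id_lfunE.
  have : w \in (W :&: A' @^-1: F 0%N)%VS by rewrite -AA' // memv_cap wW -memv_preim.
  move: Aw; rewrite memv_cap -memv_preim cF.1 !memv0 => /eqP ->.
  by case/andP=> _ /eqP.
have [i im|g [gF gI gA]] := IH; first by apply: AA'; apply: leqW.
have AF i w : (i <= m.+1)%N -> w \in W -> (A w \in F i) = (A' w \in F i).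
  move=> im wW; have := congr1 (fun U : {vspace uT} => w \in U) (AA' i im).
  by rewrite !memv_cap wW -!memv_preim.
have FS := cF.2 m; have FSP := subvP FS.
have gFm v : v \in F m -> g v \in F m by move=> vF; rewrite -(gF m) ?memv_img.
have [T [WT dWT]] : exists T, (W :&: A @^-1: F m + T = W :&: A @^-1: F m.+1)%VS
    /\ ((W :&: A @^-1: F m) :&: T = 0)%VS.
  by apply: vcomplement; rewrite capvS // lpreimS.
have TW t : t \in T -> [/\ t \in W, A t \in F m.+1 & A' t \in F m.+1].
  move=> tT; have : t \in (W :&: A @^-1: F m.+1)%VS by rewrite -WT (subvP (addvSr _ _)).
  by rewrite memv_cap -memv_preim => /andP[tW At]; rewrite -AF.
have T0 t : t \in T -> A t \in F m -> t = 0.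
  move=> tT At; apply: ((capv0P _ _).2 dWT _ _ tT).
  by rewrite memv_cap -memv_preim At; have [-> _ _] := TW _ tT.
have T0' t : t \in T -> A' t \in F m -> t = 0.
  by move=> tT; have [tW _ _] := TW _ tT; rewrite -AF //; apply: T0.
have [s [sT sA]] := lfun_section A T.
have sAT t : t \in T -> s (A t) = t.
  move=> tT; apply/eqP; rewrite -subr_eq0; apply/eqP/T0; first by rewrite memvB.
  by rewrite linearB /= sA ?memv_img // subrr mem0v.
have FT0 : (F m :&: A @: T = 0)%VS.
  by apply/capv0P=> v vF /memv_imgP[t tT e]; rewrite e in vF *; rewrite (T0 t) ?linear0.
have FT0' : (F m :&: A' @: T = 0)%VS.
  by apply/capv0P=> v vF /memv_imgP[t tT e]; rewrite e in vF *; rewrite (T0' t) ?linear0.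
have [D [FD dFD]] : exists D, ((F m + A @: T) + D = F m.+1)%VS
    /\ ((F m + A @: T) :&: D = 0)%VS.
  by apply: vcomplement; rewrite subv_add FS; apply/subvP=> _ /memv_imgP[t /TW[_ ? _] ->].
have [D' [FD' dFD']] : exists D, ((F m + A' @: T) + D = F m.+1)%VS
    /\ ((F m + A' @: T) :&: D = 0)%VS.
  by apply: vcomplement; rewrite subv_add FS; apply/subvP=> _ /memv_imgP[t /TW[_ _ ?] ->].
have dD : \dim D = \dim D'.
  have dA : \dim (A @: T) = \dim T.
    by apply: dim_limg_inj => t tT At0; apply: T0 => //; rewrite At0 mem0v.
  have dA' : \dim (A' @: T) = \dim T.
    by apply: dim_limg_inj => t tT At0; apply: T0' => //; rewrite At0 mem0v.
  apply/eqP; rewrite -(eqn_add2l (\dim (F m + A @: T))) -dimv_disjoint_sum // FD -FD'.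
  by rewrite dimv_disjoint_sum // eqn_add2r !dimv_disjoint_sum // dA dA'.
have [dl [dlD dlI]] := vspace_iso dD.
have dlD' v : v \in D -> dl v \in D' by move=> vD; rewrite -dlD memv_img.
have [h1 [h1F h1T]] := lfun_glue g (A' \o s)%VF FT0.
have [h [hFT hD]] := lfun_glue h1 dl dFD.
have hF v : v \in F m -> h v = g v.
  by move=> vF; rewrite hFT ?h1F // (subvP (addvSl _ _)).
have hT t : t \in T -> h (A t) = A' t.
  move=> tT; have At := memv_img A tT.
  by rewrite hFT ?h1T ?comp_lfunE ?sAT // (subvP (addvSr _ _)).
have decomp v : v \in F m.+1 ->
    exists f t d, [/\ f \in F m, t \in T, d \in D & v = f + A t + d].
  rewrite -FD => /memv_addP[_ /memv_addP[f fF [_ /memv_imgP[t tT ->] ->]] [d dD1 ->]].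
  by exists f, t, d.
have hI : {in F m.+1, forall v, h v = 0 -> v = 0}.
  move=> v /decomp[f [t [d [fF tT dD1 ->]]]]; rewrite !linearD /= hF // hT // hD // => hv0.
  have d0 : d = 0.
    apply: dlI => //; apply: ((capv0P _ _).2 dFD' _ _ (dlD' _ dD1)).
    have /eqP := hv0; rewrite addrC addr_eq0 => /eqP ->.
    by rewrite memvN memv_add ?gFm ?memv_img.
  move: hv0; rewrite d0 linear0 !addr0 => /eqP; rewrite addrC addr_eq0 => /eqP hv0.
  have t0 : t = 0 by apply: T0' => //; rewrite hv0 memvN gFm.
  move: hv0; rewrite t0 !linear0 addr0 => /esym/eqP; rewrite oppr_eq0 => /eqP.
  exact: gI.
exists h; split=> //.
  move=> i; rewrite leq_eqVlt => /orP[/eqP ->|].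
    apply: lfun_inj_limg => // v /decomp[f [t [d [fF tT dD1 ->]]]].
    rewrite !linearD /= hF // hT // hD //; have [_ _ At'] := TW _ tT.
    have dD'F : dl d \in F m.+1 by rewrite -FD' (subvP (addvSr _ _)) // dlD'.
    by rewrite !memvD ?(FSP _ (gFm _ fF)).
  rewrite ltnS => im; rewrite -{2}(gF i im); apply: eq_in_limg => v vF.
  by rewrite hF // (subvP (chainS cF im)).
move=> w wW Aw.
have : w \in (W :&: A @^-1: F m.+1)%VS by rewrite memv_cap wW -memv_preim.
rewrite -WT => /memv_addP[w0 /memv_capP[w0W w0F] [t tT ->]].
move: w0F; rewrite -memv_preim => w0F.
by rewrite !linearD /= (hT t) // hF // gA.
Qed.

End Filtrations.

(** * The Tits form and the descent function *)
Section Numerics.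
Variable p : 'I_3 -> nat.
Hypothesis p_gt0 : forall a, (0 < p a)%N.
Implicit Types (D : 'I_3 -> nat -> rat) (n : rat).

Definition slope : rat := \sum_a (p a)%:R^-1.

(* Twice the Tits form of the star quiver, [D a j] being the dimension of the j-th space of the
   chain [a] and [n] that of the whole space. *)
Definition tits D n : rat :=
  \sum_a \sum_(j < p a) (D a j.+1 - D a j) ^+ 2 - n ^+ 2.

(* Normalised so that one Coxeter step subtracts [(slope - 1) * n]. *)
Definition descent D n : rat :=
  \sum_a (p a)%:R^-1 * (\sum_(j < p a) D a j) - 2 * n + slope * n.

Lemma sum3 (F : 'I_3 -> rat) (c : rat) : \sum_a (F a + c) = \sum_a F a + 3 * c.
Proof. by rewrite big_split /= sumr_const card_ord mulr_natl. Qed.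

(** Cauchy-Schwarz on each arm: [p a] increments of sum [n] have squares summing to at least
    [n ^+ 2 / (p a)], as the squared deviations from the mean [m] show. *)
Lemma tits_ge D n : (forall a, D a 0%N = 0) -> (forall a, D a (p a) = n) ->
  (slope - 1) * n ^+ 2 <= tits D n.
Proof.
move=> D0 Dp; rewrite /tits mulrBl mul1r lerD2r /slope mulr_suml ler_sum // => a _.
have pa : 0 < (p a)%:R :> rat by rewrite ltr0n.
pose m := n / (p a)%:R.
have sumd : \sum_(j < p a) (D a j.+1 - D a j) = n.
  rewrite -(big_mkord xpredT (fun j => D a j.+1 - D a j)) telescope_sumr //.
  by rewrite Dp D0 subr0.
have : 0 <= \sum_(j < p a) (D a j.+1 - D a j - m) ^+ 2 by apply: sumr_ge0 => j _; exact: sqr_ge0.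
have -> : \sum_(j < p a) (D a j.+1 - D a j - m) ^+ 2
    = \sum_(j < p a) (D a j.+1 - D a j) ^+ 2 - (p a)%:R^-1 * n ^+ 2; last by rewrite subr_ge0.
transitivity (\sum_(j < p a) ((D a j.+1 - D a j) ^+ 2 - (2 * m) * (D a j.+1 - D a j) + m ^+ 2)).
  by apply: eq_bigr => j _; ring.
rewrite !big_split /= sumr_const card_ord sumrN -mulr_sumr sumd -[m ^+ 2 *+ _]mulr_natl /m.
by field; rewrite gt_eqF.
Qed.

Section Step.
Variables (D D' : 'I_3 -> nat -> rat) (n n' : rat).
Hypotheses (D0 : forall a, D a 0%N = 0) (Dp : forall a, D a (p a) = n).
Hypotheses (D'0 : forall a, D' a 0%N = 0).
Hypothesis D'S : forall a j, (j < p a)%N -> D' a j.+1 = n' - D a (p a).-1 + D a j.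
Hypothesis Dtop : \sum_a D a (p a).-1 = n + n'.

(** On each arm the increments are shifted: the last one, [n - D a (p a).-1], disappears and
    [n' - D a (p a).-1] enters in front. Over three arms the squares change by [3 (n'^2 - n^2) - 2
    (n' - n) (n + n') = n'^2 - n^2], which the central term cancels. *)
Lemma tits_step : tits D' n' = tits D n.
Proof.
have ea a : \sum_(j < p a) (D' a j.+1 - D' a j) ^+ 2
    = \sum_(j < p a) (D a j.+1 - D a j) ^+ 2 + (n' - D a (p a).-1) ^+ 2 - (n - D a (p a).-1) ^+ 2.
  have [m pm] : exists m, p a = m.+1 by exists (p a).-1; rewrite prednK.
  have Dm := Dp a; have D'Sm := @D'S a; rewrite pm /= in Dm D'Sm *.
  rewrite big_ord_recl [in RHS]big_ord_recr /= Dm D'0 D'Sm // D0.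
  rewrite (eq_bigr (fun j : 'I_m => (D a j.+1 - D a j) ^+ 2)); first by ring.
  move=> j _; rewrite /bump /= add1n !D'Sm ?ltnS //; last exact: ltnW.
  by congr (_ ^+ 2); ring.
rewrite /tits (eq_bigr _ (fun a _ => ea a)).
transitivity (\sum_a (\sum_(j < p a) (D a j.+1 - D a j) ^+ 2
   + (- 2 * (n' - n)) * D a (p a).-1 + (n' ^+ 2 - n ^+ 2)) - n' ^+ 2).
  by congr (_ - _); apply: eq_bigr => a _; ring.
by rewrite sum3 big_split /= -mulr_sumr Dtop; ring.
Qed.

Lemma descent_step : descent D' n' = descent D n - (slope - 1) * n.
Proof.
have ea a : (p a)%:R^-1 * (\sum_(j < p a) D' a j) = (p a)%:R^-1 * (\sum_(j < p a) D a j)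
   + (- 1) * D a (p a).-1 + (- n') * (p a)%:R^-1 + n'.
  have pa : (p a)%:R != 0 :> rat by rewrite pnatr_eq0 -lt0n.
  have [m pm] : exists m, p a = m.+1 by exists (p a).-1; rewrite prednK.
  have D'Sm := @D'S a; rewrite pm /= in D'Sm pa *.
  rewrite big_ord_recl [in RHS]big_ord_recr /= D'0.
  rewrite (eq_bigr (fun j : 'I_m => D a j + (n' - D a m))); last first.
    by move=> j _; rewrite /bump /= add1n D'Sm; [rewrite addrC | rewrite ltnS ltnW].
  rewrite big_split /= sumr_const card_ord -[(n' - D a m) *+ _]mulr_natl.
  by move: pa; rewrite -natr1 => pa; field.
rewrite /descent (eq_bigr _ (fun a _ => ea a)) sum3 !big_split /= -!mulr_sumr Dtop -/slope.
ring.
Qed.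
End Step.

Lemma descent_gt D n : (forall a j, 0 <= D a j) -> 0 < n -> 0 < slope -> - (2 * n) < descent D n.
Proof.
move=> D_ge0 n_gt0 s_gt0; rewrite /descent.
have : 0 <= \sum_a (p a)%:R^-1 * (\sum_(j < p a) D a j).
  by apply: sumr_ge0 => a _; rewrite mulr_ge0 ?invr_ge0 ?ler0n // sumr_ge0.
by have := mulr_gt0 s_gt0 n_gt0; lra.
Qed.
End Numerics.

(** * Systems of three chains *)
Section StarSystems.
Variables (k : fieldType) (p : 'I_3 -> nat).
Hypothesis p_gt0 : forall a, (0 < p a)%N.
Implicit Types vT wT : vectType k.

(** The length [p a] counts the centre: the terms that can vary are those of index 1 to [(p a).-1],
    the vertices of an arm of the star. *)
Definition star_sys vT (U : 'I_3 -> nat -> {vspace vT}) (V : {vspace vT}) :=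
  forall a, chain (U a) /\ forall j, (p a <= j)%N -> U a j = V.

Definition restrict vT (U : 'I_3 -> nat -> {vspace vT}) (X : {vspace vT}) :=
  fun a j => (U a j :&: X)%VS.

Definition splits vT (U : 'I_3 -> nat -> {vspace vT}) (V X Y : {vspace vT}) :=
  [/\ (X + Y = V)%VS, (X :&: Y = 0)%VS &
      forall a j, (U a j <= U a j :&: X + U a j :&: Y)%VS].

Definition indec vT (U : 'I_3 -> nat -> {vspace vT}) (V : {vspace vT}) :=
  V != 0%VS /\ forall X Y, splits U V X Y -> X = 0%VS \/ Y = 0%VS.

Definition star_iso vT wT (U : 'I_3 -> nat -> {vspace vT}) (V : {vspace vT})
    (U' : 'I_3 -> nat -> {vspace wT}) (V' : {vspace wT}) :=
  exists f : 'Hom(vT, wT), [/\ forall a j, (f @: U a j = U' a j)%VS, (f @: V = V')%VS &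
    {in V, forall v, f v = 0 -> v = 0}].

Section OneSystem.
Variables (vT : vectType k) (U : 'I_3 -> nat -> {vspace vT}) (V : {vspace vT}).
Hypothesis sysU : star_sys U V.

Lemma star_sub a j : (U a j <= V)%VS.
Proof.
have [cU Up] := sysU a; have [pj|/ltnW jp] := leqP (p a) j; first by rewrite Up.
by rewrite -(Up (p a)) // chainS.
Qed.

Lemma star_full a : U a (p a) = V. Proof. by have [_ ->] := sysU a. Qed.

Lemma star_restrict X : (X <= V)%VS -> star_sys (restrict U X) X.
Proof.
move=> XV a; have [[U0 US] Up] := sysU a; split; first split.
- by rewrite /restrict U0 cap0v.
- by move=> j; rewrite capvS.
- by move=> j pj; rewrite /restrict Up //; apply/capv_idPr.
Qed.

Lemma splits_subl X Y : splits U V X Y -> (X <= V)%VS.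
Proof. by case=> <- _ _; apply: addvSl. Qed.

Lemma splits_sym X Y : splits U V X Y -> splits U V Y X.
Proof. by case=> e d s; split=> [||a j]; [rewrite addvC|rewrite capvC|rewrite addvC; apply: s]. Qed.

Lemma splits_subr X Y : splits U V X Y -> (Y <= V)%VS.
Proof. by move/splits_sym/splits_subl. Qed.

Lemma splits_dim X Y : splits U V X Y -> (\dim X + \dim Y = \dim V)%N.
Proof. by case=> <- d _; rewrite dimv_disjoint_sum. Qed.

Lemma splits_eq X Y a j : splits U V X Y -> (U a j = U a j :&: X + U a j :&: Y)%VS.
Proof. by case=> _ _ s; apply/eqP; rewrite eqEsubv s subv_add !capvSl. Qed.

Lemma splits_trans X Y X1 X2 :
  splits U V X Y -> splits (restrict U X) X X1 X2 -> splits U V X1 (X2 + Y)%VS.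
Proof.
move=> [e d s] [e1 d1 s1]; split.
- by rewrite addvA e1.
- apply/capv0P=> v v1 /memv_addP[x2 x2X [y yY ev]].
  have vX : v \in X by rewrite -e1 (subvP (addvSl _ _)).
  have xX : x2 \in X by rewrite -e1 (subvP (addvSr _ _)).
  have y0 : y = 0.
    apply: ((capv0P _ _).2 d _ _ yY); have -> : y = v - x2 by rewrite ev addrC addKr.
    by rewrite memvB.
  by apply: ((capv0P _ _).2 d1 _ v1); rewrite ev y0 addr0.
move=> a j; apply: subv_trans (s a j) _; rewrite subv_add; apply/andP; split.
  apply: subv_trans (s1 a j) _; apply: addvS; rewrite /restrict.
    by rewrite -capvA capvS // capvSr.
  by rewrite -capvA capvS // (subv_trans (capvSr _ _)) // addvSl.
by apply: subv_trans (addvSr _ _); rewrite capvS // addvSr.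
Qed.

End OneSystem.

Lemma indec_summand vT (U : 'I_3 -> nat -> {vspace vT}) V : star_sys U V -> V != 0%VS ->
  exists X Y, splits U V X Y /\ indec (restrict U X) X.
Proof.
have [n] := ubnP (\dim V); elim: n vT U V => // n IH vT U V /ltnSE Vn sU V0.
have [ind|nind] := classic (forall X Y, splits U V X Y -> X = 0%VS \/ Y = 0%VS).
  exists V, 0%VS; split.
    split; [exact: addv0|exact: capv0|move=> a j].
    by rewrite capv0 addv0 (capv_idPl (star_sub sU a j)).
  split=> // X Y [e d s]; apply: ind; split=> // a j.
  by have := s a j; rewrite /restrict (capv_idPl (star_sub sU a j)).
have [X [Y [sXY X0 Y0]]] : exists X Y, [/\ splits U V X Y, X <> 0%VS & Y <> 0%VS].
  apply: NNPP => h; apply: nind => X Y sXY.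
  by apply: NNPP => h'; apply: h; exists X, Y; split=> // ?; apply: h'; [left|right].
have [X1 [X2 [sX iX]]] : exists X1 X2, splits (restrict U X) X X1 X2
    /\ indec (restrict (restrict U X) X1) X1.
  apply: IH; last exact/eqP.
    apply: leq_trans Vn; rewrite -(splits_dim sXY) -[X in (X < _)%N]addn0 ltn_add2l.
    by rewrite lt0n dimv_eq0; apply/eqP.
  exact: star_restrict (splits_subl sXY).
exists X1, (X2 + Y)%VS; split; first exact: splits_trans sX.
have X1X := splits_subl sX; case: iX => X10 iX; split=> // A B [e d s].
apply: iX; split=> // a j; move: (s a j).
by rewrite /restrict -!(capvA (U a j)) (capv_idPr X1X).
Qed.

Section Iso.
Variables (vT wT : vectType k).
Variables (U : 'I_3 -> nat -> {vspace vT}) (V : {vspace vT}).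
Variables (U' : 'I_3 -> nat -> {vspace wT}) (V' : {vspace wT}).
Hypotheses (sU : star_sys U V) (sU' : star_sys U' V').

Lemma star_iso_glue X Y X' Y' : splits U V X Y -> splits U' V' X' Y' ->
  star_iso (restrict U X) X (restrict U' X') X' ->
  star_iso (restrict U Y) Y (restrict U' Y') Y' -> star_iso U V U' V'.
Proof.
move=> sXY sXY' [f [fU fX fI]] [g [gU gY gI]].
have [eV d _] := sXY; have [eV' d' _] := sXY'.
have [h [hX hY]] := lfun_glue f g d; exists h.
have hV : (h @: V = V')%VS.
  by rewrite -eV -eV' limgD (eq_in_limg hX) (eq_in_limg hY) fX gY.
split=> //.
  move=> a j; rewrite (splits_eq a j sXY) (splits_eq a j sXY') limgD.
  by congr (_ + _)%VS; [rewrite -[RHS]fU|rewrite -[RHS]gU]; apply: eq_in_limg => v /memv_capP[_];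
    [apply: hX|apply: hY].
apply: lfun_inj_dim; rewrite hV -(splits_dim sXY) -(splits_dim sXY').
by rewrite -fX -gY !dim_limg_inj.
Qed.

Lemma star_iso_line : \dim V = 1%N -> \dim V' = 1%N ->
  (forall a j, \dim (U a j) = \dim (U' a j)) -> star_iso U V U' V'.
Proof.
move=> dV dV' dU; have [f [fV fI]] := vspace_iso (etrans dV (esym dV')).
exists f; split=> // a j.
have := dimvS (star_sub sU a j); rewrite dV; case e: (\dim (U a j)) => [|[|//]] _.
  have /eqP -> : U a j == 0%VS by rewrite -dimv_eq0 e.
  by apply/esym/eqP; rewrite limg0 -dimv_eq0 -dU e.
have -> : U a j = V by apply/eqP; rewrite eqEdim star_sub // dV e.
by apply/esym/eqP; rewrite fV eqEdim star_sub // dV' -dU e.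
Qed.

End Iso.

Definition top vT (U : 'I_3 -> nat -> {vspace vT}) a := U a (p a).-1.

Definition reduced vT (U : 'I_3 -> nat -> {vspace vT}) V :=
  forall a, (V <= \sum_(b | b != a) top U b)%VS.

(* A vector of [U a j], with [j] minimal such that [U a j] is not contained in the sum [T] of the
   other tops, spans a line having a complement that contains [T]. *)
Lemma nonreduced_split vT (U : 'I_3 -> nat -> {vspace vT}) V : star_sys U V ->
  ~ reduced U V -> exists X Y, splits U V X Y /\ \dim X = 1%N.
Proof.
move=> sU nr; have [a] : exists a, ~~ (V <= \sum_(b | b != a) top U b)%VS.
  by apply: NNPP => h; apply: nr => a; apply/negPn/negP => ha; apply: h; exists a.
set T := (\sum_(b | _) _)%VS => VT.
have exj : exists j, ~~ (U a j <= T)%VS by exists (p a); rewrite (star_full sU).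
have [cU _] := sU a; have [j] := ex_minnP exj.
move=> /subvPn[v vU vT0] jmin.
have vV : v \in V := subvP (star_sub sU a j) v vU.
have v0 : v != 0 by apply: contraNneq vT0 => ->; apply: mem0v.
have TV : (T <= V)%VS by apply/subv_sumP=> b _; apply: star_sub.
have vT' : (<[v]> :&: T = 0)%VS.
  apply/capv0P=> w /vlineP[c ->] cT; apply/eqP; rewrite scaler_eq0 orbC.
  by apply: contraR vT0; rewrite (negPf v0) /= => c0; rewrite -[v](scalerK c0) memvZ.
have [D [TD dTD]] : exists D, (<[v]> + T + D = V)%VS /\ ((<[v]> + T) :&: D = 0)%VS.
  by apply: vcomplement; rewrite subv_add TV -memvE vV.
exists <[v]>%VS, (T + D)%VS; split; last by rewrite dim_vline v0.
have e : (<[v]> + (T + D) = V)%VS by rewrite addvA.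
split=> //.
  apply/capv0P=> w wv /memv_addP[t tT [d dD ew]].
  have d0 : d = 0.
    apply: ((capv0P _ _).2 dTD _ _ dD).
    have -> : d = w - t by rewrite ew addrC addKr.
    by rewrite memv_add ?memvN.
  by apply: ((capv0P _ _).2 vT' _ wv); rewrite ew d0 addr0.
have sub b i : (U b i <= T + D)%VS -> (U b i <= U b i :&: <[v]> + U b i :&: (T + D))%VS.
  by move=> UT; rewrite (capv_idPl UT) addvSr.
have vin b i : v \in U b i -> (U b i <= U b i :&: <[v]> + U b i :&: (T + D))%VS.
  move=> vUi; have vi : (<[v]> <= U b i)%VS by rewrite -memvE.
  by rewrite (capv_idPr vi) [(U b i :&: (T + D))%VS]capvC vspace_modl // e subv_cap star_sub /=.
move=> b i; have [bi|ib] := leqP (p b) i; first by apply: vin; have [_ ->] := sU b.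
have [eba|ba] := eqVneq b a.
  rewrite eba; have [ji|ij] := leqP j i; first by apply: vin; apply: subvP (chainS cU ji) v vU.
  apply: sub; apply: subv_trans (addvSl T D); apply: contraLR ij => h.
  by rewrite -leqNgt jmin.
apply: sub; apply: subv_trans (addvSl T D); apply: subv_trans (sumv_sup b _ _) => //.
by apply: chainS; [have [] := sU b|rewrite -ltnS prednK].
Qed.

End StarSystems.

(** * The Coxeter functor *)
Section Evaluation.
Variables (k : fieldType) (vT : vectType k).

Definition arm_eval (a : 'I_3) (u : {ffun 'I_3 -> vT}) : vT := u a.

Fact arm_eval_linear a : linear (arm_eval a).
Proof. by move=> c u v; rewrite /arm_eval !ffunE. Qed.

HB.instance Definition _ a :=
  GRing.isLinear.Build k {ffun 'I_3 -> vT} vT _ (arm_eval a) (arm_eval_linear a).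

Definition arm a : 'Hom({ffun 'I_3 -> vT}, vT) := linfun (arm_eval a).

Lemma armE a u : arm a u = u a. Proof. by rewrite lfunE. Qed.
End Evaluation.

Section Coxeter.
Variables (k : fieldType) (p : 'I_3 -> nat).
Hypothesis p_gt0 : forall a, (0 < p a)%N.

Section Functor.
Variables (vT : vectType k) (U : 'I_3 -> nat -> {vspace vT}) (V : {vspace vT}).

(* The reflection at the centre of the star followed by the reflections along the arms, written
   for chains of subspaces. *)
Definition coxV : {vspace {ffun 'I_3 -> vT}} :=
  (lker (\sum_a arm vT a)%R :&: \bigcap_a (arm vT a @^-1: top p U a))%VS.

(** Since [U a 0 = 0], the term of index 1 consists of the triples vanishing at [a]. The whole of
    [coxV] is reached at index [p a], because its triples satisfy [u a \in top p U a] by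
    definition. *)
Definition coxU (a : 'I_3) (j : nat) : {vspace {ffun 'I_3 -> vT}} :=
  if j is j'.+1 then (coxV :&: arm vT a @^-1: U a j')%VS else 0%VS.

Lemma coxVP (u : {ffun 'I_3 -> vT}) :
  reflect ((forall a, u a \in top p U a) /\ \sum_a u a = 0) (u \in coxV).
Proof.
rewrite memv_cap memv_ker sum_lfunE (eq_bigr _ (fun a _ => armE a u)).
apply: (iffP andP) => [[/eqP e]|[h e]].
  rewrite memvE => /subv_bigcapP h; split=> // a.
  by have := h a isT; rewrite -memvE -memv_preim armE.
by split; [apply/eqP|rewrite memvE; apply/subv_bigcapP=> a _; rewrite -memvE -memv_preim armE].
Qed.

Lemma mem_coxU a j u : (u \in coxU a j.+1) = (u \in coxV) && (u a \in U a j).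
Proof. by rewrite memv_cap -memv_preim armE. Qed.

Hypothesis sysU : star_sys p U V.

Lemma cox_sys : star_sys p coxU coxV.
Proof.
move=> a; have [cU _] := sysU a; split; first split=> //.
  case=> [|j]; first exact: sub0v.
  by apply: capvS; [exact: subvv|apply: lpreimS; apply: cU.2].
case=> [|j] pj; first by move: pj; rewrite leqNgt p_gt0.
apply/capv_idPl/subvP=> u /coxVP[uU _]; rewrite -memv_preim armE.
apply: subvP (uU a); apply: chainS => //.
by rewrite -ltnS prednK.
Qed.

Hypothesis redU : reduced p U V.

Lemma top_sub a : (top p U a <= V)%VS. Proof. exact: star_sub. Qed.

(** This is what [reduced] is for: [- v] is a sum of vectors from the other two tops, and these
    complete [v] to a triple of sum zero. *)
Lemma cox_surj a v : v \in top p U a -> exists2 u, u \in coxV & u a = v.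
Proof.
move=> vU; have vV : - v \in V by rewrite memvN (subvP (top_sub a)).
have /memv_sumP[w wU e] := subvP (redU a) _ vV.
exists [ffun b => if b == a then v else w b]; last by rewrite ffunE eqxx.
apply/coxVP; split=> [b|].
  by rewrite ffunE; case: eqVneq => [->|] // ba; apply: wU.
rewrite (bigD1 a) //= ffunE eqxx -[v]opprK e addrC; apply/eqP; rewrite subr_eq0; apply/eqP.
by apply: eq_bigr => b ba; rewrite ffunE (negPf ba).
Qed.

Lemma cox_img a j : (j < p a)%N -> (arm vT a @: coxU a j.+1 = U a j)%VS.
Proof.
move=> jp; apply/eqP; rewrite eqEsubv; apply/andP; split; apply/subvP=> v.
  by move=> /memv_imgP[u]; rewrite mem_coxU => /andP[_ ?] ->; rewrite armE.
move=> vU; have [cU _] := sysU a.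
have [|u uV uv] := @cox_surj a v; first by apply: subvP vU; apply: chainS; rewrite // -ltnS prednK.
by apply/memv_imgP; exists u; rewrite ?armE // mem_coxU uV uv.
Qed.

Lemma top_sum v : v \in V -> exists2 u : {ffun 'I_3 -> vT},
  (forall a, u a \in top p U a) & v = \sum_a u a.
Proof.
move=> /(subvP (redU ord0))/memv_sumP[w wU ->].
exists [ffun b => if b == ord0 then 0 else w b].
  by move=> b; rewrite ffunE; case: eqVneq => [_|/wU//]; rewrite mem0v.
rewrite [RHS](bigD1 ord0) //= ffunE eqxx add0r.
by apply: eq_bigr => b b0; rewrite ffunE (negPf b0).
Qed.

(** Evaluation at [a] maps [coxU a j.+1] onto [U a j] with the same kernel [coxU a 1] for every [j];
    comparison with the last term eliminates this kernel. *)
Lemma dim_coxU a j : (j < p a)%N ->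
  (\dim (coxU a j.+1) + \dim (top p U a) = \dim coxV + \dim (U a j))%N.
Proof.
move=> jp.
have dimU i : (i < p a)%N -> (\dim (coxU a i.+1) = \dim (coxU a 1) + \dim (U a i))%N.
  move=> ip; rewrite -(limg_ker_dim (arm vT a) (coxU a i.+1)) cox_img //; congr (\dim _ + _)%N.
  have [[U0 _] _] := sysU a.
  apply/vspaceP=> u; rewrite memv_cap memv_ker armE !mem_coxU U0 memv0 -andbA.
  by case: eqVneq => [->|]; rewrite ?andbF ?mem0v.
have [_ /(_ (p a) (leqnn _)) e] := cox_sys a.
have pp : ((p a).-1 < p a)%N by rewrite prednK.
by rewrite dimU // -e -[in RHS](prednK (p_gt0 a)) (dimU _ pp) -/(top p U a) addnAC.
Qed.

(** The triples vanishing at [a0] form an antidiagonal copy of the intersection of the other two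
    tops. These tops span [V], so the dimension formula for a sum and an intersection applies. *)
Lemma dim_coxV : (\dim coxV + \dim V = \sum_a \dim (top p U a))%N.
Proof.
pose a0 : 'I_3 := ord0; pose a1 : 'I_3 := lift ord0 ord0.
pose a2 : 'I_3 := lift ord0 (lift ord0 ord0).
have eV : (V = top p U a1 + top p U a2)%VS.
  apply/eqP; rewrite eqEsubv subv_add !top_sub !andbT.
  apply: subv_trans (redU a0) _; apply/subv_sumP=> b; rewrite -(inj_eq val_inj) /=.
  case: b => [[|[|[|//]]]] //= b3 _.
    by apply: subv_trans (addvSl _ _); rewrite (_ : Ordinal b3 = a1) //; apply: val_inj.
  by apply: subv_trans (addvSr _ _); rewrite (_ : Ordinal b3 = a2) //; apply: val_inj.
have U00 := (sysU a0).1.1.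
have e0 : (\dim coxV = \dim (coxU a0 1) + \dim (top p U a0))%N.
  by have := @dim_coxU a0 0 (p_gt0 a0); rewrite U00 dimv0 addn0 => <-.
have e1 : \dim (coxU a0 1) = \dim (top p U a1 :&: top p U a2).
  have sum0 u : u \in coxU a0 1 -> u a2 = - u a1 /\ forall b, u b \in top p U b.
    rewrite mem_coxU U00 memv0 => /andP[/coxVP[uU]].
    rewrite !big_ord_recl big_ord0 addr0 => e /eqP u0; split=> //.
    by move: e; rewrite u0 add0r => /eqP; rewrite addrC addr_eq0 => /eqP.
  have <- : (arm vT a1 @: coxU a0 1 = top p U a1 :&: top p U a2)%VS.
    apply/eqP; rewrite eqEsubv; apply/andP; split; apply/subvP=> v.
      move=> /memv_imgP[u /sum0[u2 uU] ->]; rewrite armE memv_cap uU /=.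
      by rewrite -[u a1]opprK -u2 memvN.
    move=> /memv_capP[v1 v2]; apply/memv_imgP.
    exists [ffun b => if b == a0 then 0 else if b == a1 then v else - v]; last first.
      by rewrite armE ffunE.
    rewrite mem_coxU ffunE eqxx mem0v andbT; apply/coxVP; split=> [b|].
      rewrite ffunE; case: eqVneq => [_|b0]; first exact: mem0v.
      case: eqVneq => [->//|b1]; rewrite memvN (_ : b = a2) //; apply: val_inj.
      move: b0 b1; rewrite -!(inj_eq val_inj) /=.
      by case: b => [[|[|[|]]]].
    by rewrite !big_ord_recl big_ord0 !ffunE /= add0r addr0 subrr.
  apply/esym/dim_limg_inj=> u uU; have [u2 _] := sum0 u uU; rewrite armE => u1.
  apply/ffunP=> b; rewrite ffunE; case: b => [[|[|[|//]]]] b3.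
  - move: uU; rewrite mem_coxU U00 memv0 => /andP[_ /eqP <-].
    by congr (u _); apply: val_inj.
  - by rewrite -[RHS]u1; congr (u _); apply: val_inj.
  by rewrite -[RHS]oppr0 -u1 -u2; congr (u _); apply: val_inj.
rewrite e0 e1 eV addnAC [(\dim (_ :&: _) + _)%N]addnC dimv_sum_cap.
by rewrite !big_ord_recl big_ord0 addn0 addnC.
Qed.

(** Splittings are carried back so that indecomposability can be carried forward. Directness uses
    the given splitting twice: on [coxU a 1], to separate the evaluations at one arm, and on [coxV],
    to separate their sums. *)
Lemma cox_splits X Y : splits coxU coxV X Y ->
  splits U V (\sum_a arm vT a @: X)%VS (\sum_a arm vT a @: Y)%VS.
Proof.
move=> sXY; have [e d s] := sXY.
have XV := splits_subl sXY; have YV := splits_subr sXY.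
have disj a : (arm vT a @: X :&: arm vT a @: Y = 0)%VS.
  apply/capv0P=> _ /memv_imgP[x xX ->] /memv_imgP[y yY]; rewrite !armE => xy.
  have U0 := (sysU a).1.1.
  have : x - y \in coxU a 1.
    rewrite mem_coxU U0 memv0 !ffunE xy subrr eqxx andbT.
    by rewrite memvB ?(subvP XV _ xX) ?(subvP YV _ yY).
  move/(subvP (s a 1%N))/memv_addP=> [x1 /memv_capP[x1U x1X] [y1 /memv_capP[y1U y1Y] exy]].
  have ex : x = x1.
    apply/eqP; rewrite -subr_eq0; apply/eqP; apply: ((capv0P _ _).2 d).
      by rewrite memvB.
    have -> : x - x1 = y1 + y.
      by apply/eqP; rewrite subr_eq addrAC [y1 + _]addrC -exy subrK.
    by rewrite memvD.
  by move: x1U; rewrite -ex mem_coxU U0 memv0 => /andP[_ /eqP].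
have piece a j : (j < p a)%N -> U a j =
    (arm vT a @: (coxU a j.+1 :&: X) + arm vT a @: (coxU a j.+1 :&: Y))%VS.
  by move=> jp; rewrite -limgD -(splits_eq a j.+1 sXY) cox_img.
have sumS a (Z : {vspace _}) : (arm vT a @: Z <= \sum_b arm vT b @: Z)%VS.
  exact: (sumv_sup a).
have UXY a j : (j < p a)%N -> (U a j <= U a j :&: (\sum_b arm vT b @: X)
     + U a j :&: (\sum_b arm vT b @: Y))%VS.
  move=> jp; rewrite {1}piece //; apply: addvS; rewrite subv_cap; apply/andP; split.
  - by rewrite -(cox_img jp) limgS // capvSl.
  - by apply: subv_trans (sumS a X); rewrite limgS // capvSr.
  - by rewrite -(cox_img jp) limgS // capvSl.
  - by apply: subv_trans (sumS a Y); rewrite limgS // capvSr.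
have imgV a (Z : {vspace _}) : (Z <= coxV)%VS -> (arm vT a @: Z <= top p U a)%VS.
  move=> ZV; apply/subvP=> _ /memv_imgP[z zZ ->]; rewrite armE.
  by have /coxVP[] := subvP ZV z zZ.
have eV : (\sum_b arm vT b @: X + \sum_b arm vT b @: Y = V)%VS.
  apply/eqP; rewrite eqEsubv subv_add; apply/andP; split.
    by apply/andP; split; apply/subv_sumP=> b _; apply: subv_trans (imgV _ _ _) (top_sub b).
  apply/subvP=> v /top_sum[u uU ->]; apply: memv_suml => a _.
  have pp : ((p a).-1 < p a)%N by rewrite prednK.
  by apply: subvP (uU a); apply: subv_trans (UXY _ _ pp) _; apply: addvS; apply: capvSr.
split=> //; last first.
  move=> a j; have [pj|] := leqP (p a) j; last exact: UXY.
  rewrite (sysU a).2 // -{1}eV; apply: addvS; rewrite subv_cap subvv andbT -eV.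
    exact: addvSl.
  exact: addvSr.
apply/capv0P=> v /memv_sumP[x xX ex] /memv_sumP[y yY ey].
(* Two expressions of [v] differ by a triple of sum zero, an element of [coxV]. Splitting it
   identifies [x], arm by arm, with an element [x'] of [X], whose entries sum to zero. *)
pose u := [ffun a => x a - y a].
have : u \in coxV.
  apply/coxVP; split=> [a|].
    rewrite ffunE memvB //; first by apply: subvP (xX a isT); apply: imgV.
    by apply: subvP (yY a isT); apply: imgV.
  by rewrite (eq_bigr _ (fun a _ => ffunE _ a)) sumrB -ex -ey subrr.
rewrite -e => /memv_addP[x' x'X [y' y'Y eu]].
have xx' a : x a = x' a.
  have exy : x a - x' a = y a + y' a.
    have := congr1 (fun f : {ffun _} => f a) eu; rewrite /u !ffunE => /eqP.
    rewrite subr_eq => /eqP ->.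
    by rewrite -(addrA (x' a)) [x' a + _]addrC addrK addrC.
  apply/eqP; rewrite -subr_eq0; apply/eqP; apply: ((capv0P _ _).2 (disj a)).
    by rewrite memvB ?xX // -armE memv_img.
  by rewrite exy memvD ?yY // -armE memv_img.
rewrite ex (eq_bigr _ (fun a _ => xx' a)).
by have /coxVP[] := subvP XV x' x'X.
Qed.

Lemma cox_neq0 : V != 0%VS -> coxV != 0%VS.
Proof.
apply: contraNneq => c0; rewrite -subv0; apply/subvP=> v /top_sum[u uU ->].
rewrite memv0 big1 // => a _; have [w] := cox_surj (uU a).
by rewrite c0 memv0 => /eqP -> <-; rewrite ffunE.
Qed.

Lemma cox_indec : indec U V -> indec coxU coxV.
Proof.
move=> [V0 iU]; split=> [|X Y sXY]; first exact: cox_neq0.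
have img0 (Z : {vspace {ffun 'I_3 -> vT}}) : (\sum_a arm vT a @: Z = 0)%VS -> Z = 0%VS.
  move=> Z0; apply/eqP; rewrite -subv0; apply/subvP=> z zZ; rewrite memv0; apply/eqP/ffunP=> a.
  rewrite ffunE -armE; apply/eqP; rewrite -memv0 -Z0.
  by apply: (subvP (sumv_sup a _ (subvv _))) => //; apply: memv_img.
by have [/img0|/img0] := iU _ _ (cox_splits sXY); [left|right].
Qed.

End Functor.

(* [top U a] is recovered as [coxV / coxU a 1], and [V] as the sum of the tops modulo [coxV]. *)
Lemma cox_iso (vT wT : vectType k) (U : 'I_3 -> nat -> {vspace vT}) V
    (U' : 'I_3 -> nat -> {vspace wT}) V' :
  star_sys p U V -> star_sys p U' V' -> reduced p U V -> reduced p U' V' ->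
  \dim V = \dim V' ->
  star_iso (coxU U) (coxV U) (coxU U') (coxV U') -> star_iso U V U' V'.
Proof.
move=> sU sU' rU rU' dV [th [thU thV thI]].
pose s a := sval (lfun_section (arm vT a) (coxV U)).
have sV a v : s a v \in coxV U by have [] := svalP (lfun_section (arm vT a) (coxV U)).
have sK a v : v \in top p U a -> s a v a = v.
  move=> /(cox_surj sU rU)[u uV <-]; have [_] := svalP (lfun_section (arm vT a) (coxV U)).
  by move=> /(_ (u a)); rewrite -!armE => -> //; apply: memv_img.
pose t a := (arm wT a \o th \o s a)%VF.
have tE a u : u \in coxV U -> t a (u a) = th u a.
  move=> uV; rewrite /t !comp_lfunE armE; apply/eqP; rewrite -subr_eq0.
  have uU : u a \in top p U a by have /coxVP[] := uV.
  have : th (s a (u a) - u) \in coxU U' a 1.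
    rewrite -thU memv_img // mem_coxU memvB //= !ffunE sK // subrr.
    exact: mem0v.
  by rewrite mem_coxU (sU' a).1.1 memv0 linearB !ffunE => /andP[].
clearbody t; pose S := (\sum_a arm vT a)%R; pose T := (\bigcap_a (arm vT a @^-1: top p U a))%VS.
have TP u : u \in T <-> forall a, u a \in top p U a.
  rewrite memvE; split=> [/subv_bigcapP h a|h].
    by have := h a isT; rewrite -memvE -memv_preim armE.
  by apply/subv_bigcapP=> a _; rewrite -memvE -memv_preim armE.
have SE u : S u = \sum_a u a by rewrite sum_lfunE; apply: eq_bigr => a _; rewrite armE.
have [r [rT rK]] := lfun_section S T.
pose f := (\sum_a (t a \o arm vT a \o r)%VF).
have fE u : u \in T -> f (\sum_a u a) = \sum_a t a (u a).
  move=> uT; have rS : S (r (S u)) = S u by rewrite rK // memv_img.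
  have : r (S u) - u \in coxV U.
    apply/coxVP; split=> [a|]; first by have /TP/(_ a) := memvB (rT (S u)) uT.
    by rewrite -SE linearB /= rS subrr.
  move=> dV0; rewrite -SE /f sum_lfunE; apply/eqP; rewrite -subr_eq0 -sumrB.
  have /coxVP[_ e0] : th (r (S u) - u) \in coxV U' by rewrite -thV memv_img.
  apply/eqP; rewrite -[RHS]e0; apply: eq_bigr => a _.
  rewrite !comp_lfunE armE -tE // !ffunE linearB /=.
  by congr (_ - _).
have ft a v : v \in top p U a -> f v = t a v.
  move=> vU; pose u : {ffun 'I_3 -> vT} := [ffun b => if b == a then v else 0].
  have uE b : u b = if b == a then v else 0 by rewrite ffunE.
  have -> : v = \sum_b u b.
    by rewrite (bigD1 a) //= uE eqxx big1 ?addr0 // => b ba; rewrite uE (negPf ba).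
  rewrite fE; last by apply/TP=> b; rewrite uE; case: eqVneq => [->//|_]; rewrite mem0v.
  rewrite (bigD1 a) //= [in RHS](bigD1 a) //= uE eqxx ![\sum_(b | b != a) _]big1 ?addr0 //.
    by move=> b ba; rewrite uE (negPf ba).
  by move=> b ba; rewrite uE (negPf ba) linear0.
have fU a j : (j < p a)%N -> (f @: U a j = U' a j)%VS.
  move=> jp; rewrite -(cox_img sU rU jp) -(cox_img sU' rU' jp) -thU.
  apply/vspaceP=> w.
  apply/memv_imgP/memv_imgP => [[_ /memv_imgP[u uU ->]]|[_ /memv_imgP[u uU ->]]] ->.
    have [uV _] := andP (etrans (esym (mem_coxU _ _ _ _)) uU).
    have uT : u a \in top p U a by have /coxVP[] := uV.
    by exists (th u); [apply: memv_img|rewrite !armE (ft a) // tE].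
  have [uV _] := andP (etrans (esym (mem_coxU _ _ _ _)) uU).
  have uT : u a \in top p U a by have /coxVP[] := uV.
  by exists (u a); [rewrite -armE memv_img|rewrite !armE (ft a) // tE].
have pp a : ((p a).-1 < p a)%N by rewrite prednK.
have fV : (f @: V = V')%VS.
  apply/eqP; rewrite eqEsubv; apply/andP; split; apply/subvP=> w.
    move=> /memv_imgP[v /(top_sum rU)[u uU ->] ->]; rewrite linear_sum memv_suml // => a _.
    by apply: subvP (top_sub sU' a) _ _; rewrite /top -fU ?memv_img.
  move=> /(top_sum rU')[u uU ->]; apply: memv_suml => a _.
  have := uU a; rewrite /top -fU //; apply: subvP; apply: limgS; exact: top_sub.
exists f; split=> // [a j|]; last by apply: lfun_inj_dim; rewrite fV dV.
have [pj|] := leqP (p a) j; last exact: fU.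
by rewrite (sU a).2 // (sU' a).2.
Qed.

End Coxeter.

(** * Systems of finite type *)
Section FiniteType.
Variables (k : fieldType) (p : 'I_3 -> nat).
Hypothesis p_gt0 : forall a, (0 < p a)%N.
Hypothesis p_dynkin : 1 < slope p.
Implicit Types vT wT : vectType k.

Definition dims vT (U : 'I_3 -> nat -> {vspace vT}) a j : rat := (\dim (U a j))%:R.

Section OneSystem.
Variables (vT : vectType k) (U : 'I_3 -> nat -> {vspace vT}) (V : {vspace vT}).
Hypotheses (sysU : star_sys p U V).

Lemma dims0 a : dims U a 0%N = 0.
Proof. by rewrite /dims (sysU a).1.1 dimv0. Qed.

Lemma dims_full a : dims U a (p a) = (\dim V)%:R.
Proof. by rewrite /dims (star_full sysU). Qed.

Hypothesis redU : reduced p U V.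

Lemma dims_cox a j : (j < p a)%N ->
  dims (coxU p U) a j.+1 = (\dim (coxV p U))%:R - dims U a (p a).-1 + dims U a j.
Proof.
move=> jp; apply: (addIr (dims U a (p a).-1)); rewrite addrAC subrK /dims -!natrD.
by rewrite (dim_coxU p_gt0 sysU redU jp).
Qed.

Lemma dims_top : \sum_a dims U a (p a).-1 = (\dim V)%:R + (\dim (coxV p U))%:R.
Proof. by rewrite -natr_sum -natrD addnC (dim_coxV p_gt0 sysU redU). Qed.

Lemma tits_cox : tits p (dims (coxU p U)) (\dim (coxV p U))%:R = tits p (dims U) (\dim V)%:R.
Proof.
apply: tits_step dims_cox dims_top => // a; [exact: dims0|exact: dims_full|].
by rewrite /dims dimv0.
Qed.

Lemma descent_cox : descent p (dims (coxU p U)) (\dim (coxV p U))%:R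
  = descent p (dims U) (\dim V)%:R - (slope p - 1) * (\dim V)%:R.
Proof.
apply: descent_step dims_cox dims_top => // a.
by rewrite /dims dimv0.
Qed.

End OneSystem.

Lemma indec_reduced vT (U : 'I_3 -> nat -> {vspace vT}) V :
  star_sys p U V -> indec U V -> \dim V != 1%N -> reduced p U V.
Proof.
move=> sU [V0 iU] dV; apply: NNPP => /(nonreduced_split p_gt0 sU)[X [Y [sXY dX]]].
have [X0|Y0] := iU _ _ sXY; first by rewrite X0 dimv0 in dX.
by have := splits_dim sXY; rewrite Y0 dimv0 addn0 dX => e; rewrite -e in dV.
Qed.

(** The dimensions determine those of the Coxeter system, so both systems shrink in parallel until
    they are lines, and [cox_iso] brings the isomorphism back. Two bounds are fixed before the
    induction: one on the dimension at every stage, one on the number of steps. *)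
Lemma indec_unique vT wT (U : 'I_3 -> nat -> {vspace vT}) V
    (U' : 'I_3 -> nat -> {vspace wT}) V' :
  star_sys p U V -> star_sys p U' V' -> indec U V -> indec U' V' ->
  (forall a j, \dim (U a j) = \dim (U' a j)) -> star_iso U V U' V'.
Proof.
have s1 : 0 < slope p - 1 by rewrite subr_gt0.
(* [tits_ge] bounds the squared dimension by [x], and [x <= B ^+ 2]; as [tits] is invariant, [B]
   bounds the dimension at every stage. *)
pose x := tits p (dims U) (\dim V)%:R / (slope p - 1).
pose B := Num.bound x.
have : tits p (dims U) (\dim V)%:R <= (slope p - 1) * B%:R ^+ 2.
  rewrite mulrC -ler_pdivrMr // -/x.
  have [x0|x0] := ltP x 0; first by apply: le_trans (ltW x0) (sqr_ge0 _).
  have xB := archi_boundP x0; apply: le_trans (ltW xB) _.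
  rewrite -/B -natrX ler_nat expnS expn1; case: (B) => // b.
  by rewrite leq_pmulr.
(* A nonzero space of dimension at most [B] has [descent] above [- 2 * B], and a step lowers it by
   at least [slope p - 1], so [y] bounds the number of steps. *)
pose y := (descent p (dims U) (\dim V)%:R + 2 * B%:R) / (slope p - 1).
have : descent p (dims U) (\dim V)%:R + 2 * B%:R <= (Num.bound y)%:R * (slope p - 1).
  rewrite -ler_pdivrMr // -/y; have [y0|y0] := ltP y 0; last exact/ltW/archi_boundP.
  exact: le_trans (ltW y0) (ler0n _ _).
move: (B) (Num.bound y) => {y B x} C N.
elim: N vT wT U V U' V' => [|N IH] vT wT U V U' V' yN xC sU sU' iU iU' dU.
all: have [V0 _] := iU; have n0 : 0 < (\dim V)%:R :> rat by rewrite ltr0n lt0n dimv_eq0.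
  have nC : (\dim V)%:R <= C%:R :> rat.
    have := le_trans (tits_ge p_gt0 (dims0 sU) (dims_full sU)) xC.
    by rewrite ler_pM2l // ler_sqr ?nnegrE ?ler0n.
  have s0 : 0 < slope p by lra.
  have := @descent_gt p (dims U) _ (fun a j => ler0n _ _) n0 s0.
  by move: yN; lra.
have dV : \dim V = \dim V' by rewrite -(star_full sU ord0) dU (star_full sU').
have [d1|d1] := eqVneq (\dim V) 1%N; first by apply: star_iso_line; rewrite -?dV.
have rU := indec_reduced sU iU d1.
have rU' : reduced p U' V' by apply: indec_reduced; rewrite -?dV.
apply: cox_iso => //; have dcV : \dim (coxV p U) = \dim (coxV p U').
  apply/eqP; rewrite -(eqn_add2r (\dim V)) (dim_coxV p_gt0 sU rU) dV.
  by rewrite (dim_coxV p_gt0 sU' rU'); apply/eqP/eq_bigr => a _; apply: dU.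
apply: IH; rewrite ?(tits_cox sU rU) ?(descent_cox sU rU) //.
- have : (slope p - 1) <= (slope p - 1) * (\dim V)%:R.
    by rewrite ler_peMr ?(ltW s1) // ler1n lt0n dimv_eq0.
  move: yN; rewrite -[N.+1%:R]natr1; lra.
- exact: cox_sys.
- exact: cox_sys.
- exact: cox_indec.
- exact: cox_indec.
move=> a [|j]; first by rewrite !dimv0.
have [pj|jp] := leqP (p a) j.
  by rewrite (cox_sys p_gt0 sU a).2 ?(cox_sys p_gt0 sU' a).2 ?leqW.
apply/eqP; rewrite -(eqn_add2r (\dim (top p U a))) (dim_coxU p_gt0 sU rU jp) dcV {1}/top !dU.
by rewrite (dim_coxU p_gt0 sU' rU' jp).
Qed.

(** * Labels of systems by the dimensions of their indecomposable summands *)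

Section Labels.
Variables (N M : nat).
Hypothesis pM : forall a, (p a <= M)%N.

Definition code := {ffun 'I_3 * 'I_M.+1 -> 'I_N.+1}.

(** [inord] sends numbers above [N] to 0, so the code is faithful only for spaces of dimension at
    most [N]. *)
Definition dim_code vT (U : 'I_3 -> nat -> {vspace vT}) : code :=
  [ffun x : 'I_3 * 'I_M.+1 => inord (\dim (U x.1 x.2))].

(** A relation, since a decomposition has to be chosen: a system may carry several lists, but two
    systems that share one are isomorphic. *)
Fixpoint labelled (s : seq code) vT (U : 'I_3 -> nat -> {vspace vT}) (V : {vspace vT}) : Prop :=
  if s is c :: s' then exists X Y, [/\ splits U V X Y, indec (restrict U X) X,
    dim_code (restrict U X) = c & labelled s' (restrict U Y) Y]
  else V = 0%VS.

Lemma labelled_exists vT (U : 'I_3 -> nat -> {vspace vT}) V : star_sys p U V ->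
  exists2 s, labelled s U V & (size s <= \dim V)%N.
Proof.
have [n] := ubnP (\dim V); elim: n U V => // n IH U V /ltnSE Vn sU.
have [->|V0] := eqVneq V 0%VS; first by exists [::]; rewrite ?dimv0.
have [X [Y [sXY iX]]] := indec_summand sU V0.
have YV := splits_subr sXY; have dX : (0 < \dim X)%N.
  by rewrite lt0n dimv_eq0; case: iX.
have dXY := splits_dim sXY.
have [|s sY ss] := IH (restrict U Y) Y _ (star_restrict sU YV).
  by apply: leq_trans Vn; rewrite -dXY -[X in (X < _)%N]add0n ltn_add2r.
exists (dim_code (restrict U X) :: s); first by exists X, Y.
by rewrite /= -dXY -add1n leq_add.
Qed.

Lemma labelled_iso s vT wT (U : 'I_3 -> nat -> {vspace vT}) V
    (U' : 'I_3 -> nat -> {vspace wT}) V' :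
  star_sys p U V -> star_sys p U' V' -> (\dim V <= N)%N -> (\dim V' <= N)%N ->
  labelled s U V -> labelled s U' V' -> star_iso U V U' V'.
Proof.
elim: s U V U' V' => [|c s IH] U V U' V' sU sU' dV dV' /=.
  move=> V0 V0'; exists 0; split=> [a j||v]; first last.
  - by rewrite V0 memv0 => /eqP.
  - by rewrite lim0g V0'.
  have := star_sub sU' a j; rewrite V0' subv0 => /eqP ->.
  exact: lim0g.
move=> [X [Y [sXY iX cX sY]]] [X' [Y' [sXY' iX' cX' sY']]].
have dimX := splits_dim sXY; have dimX' := splits_dim sXY'.
have XV := splits_subl sXY; have XV' := splits_subl sXY'.
have rX := star_restrict sU XV; have rX' := star_restrict sU' XV'.
apply: (star_iso_glue sXY sXY'); last first.
  apply: IH => //.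
  - exact: (star_restrict sU (splits_subr sXY)).
  - exact: (star_restrict sU' (splits_subr sXY')).
  - by apply: leq_trans dV; rewrite -dimX leq_addl.
  - by apply: leq_trans dV'; rewrite -dimX' leq_addl.
apply: indec_unique => // a j.
have small i : (i <= p a)%N -> \dim (restrict U X a i) = \dim (restrict U' X' a i).
  move=> ip; have iM : (i < M.+1)%N by rewrite ltnS (leq_trans ip).
  have := congr1 (fun f : code => f (a, Ordinal iM)) (etrans cX (esym cX')).
  rewrite !ffunE /= => /(congr1 val); rewrite /= !inordK //.
    rewrite ltnS (leq_trans (dimvS (star_sub rX' a i))) //.
    by apply: leq_trans dV'; apply: dimvS.
  rewrite ltnS (leq_trans (dimvS (star_sub rX a i))) //.
  by apply: leq_trans dV; apply: dimvS.
have [/small //|/ltnW pj] := leqP j (p a).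
by rewrite (rX a).2 // (rX' a).2 // -(star_full rX a) -(star_full rX' a) small.
Qed.

End Labels.

(** Every summand is nonzero, so there are at most [N] of them and bounded sequences of codes
    suffice as labels. *)
Lemma star_finite (N : nat) :
  exists (T : finType) (R : forall vT, ('I_3 -> nat -> {vspace vT}) -> {vspace vT} -> T -> Prop),
    (forall vT (U : 'I_3 -> nat -> {vspace vT}) V, star_sys p U V -> (\dim V <= N)%N ->
       exists t, R vT U V t) /\
    (forall vT wT (U : 'I_3 -> nat -> {vspace vT}) V (U' : 'I_3 -> nat -> {vspace wT}) V' t,
       star_sys p U V -> star_sys p U' V' -> (\dim V <= N)%N -> (\dim V' <= N)%N ->
       R vT U V t -> R wT U' V' t -> star_iso U V U' V').
Proof.
pose M := \max_a p a; exists (N.-bseq (code N M)).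
exists (fun vT U V (t : N.-bseq (code N M)) => labelled t U V); split.
  move=> vT U V sU dV; have [s ls ss] := labelled_exists N M sU.
  by exists (Bseq (leq_trans ss dV)).
move=> vT wT U V U' V' t; apply: labelled_iso => a.
exact: leq_bigmax.
Qed.

End FiniteType.

(** * Conjugation by block triangular matrices *)
Section FiniteUpTo.
Variable E : eqType.
Implicit Types (P : E -> Prop) (rel : E -> E -> Prop).

Definition finite_upto P rel :=
  exists s : seq E, (forall y, y \in s -> P y) /\
    forall x, P x -> exists2 y, y \in s & rel x y.

Lemma finite_upto_label P rel (T : finType) (R : E -> T -> Prop) :
  (forall x, P x -> exists t, R x t) ->
  (forall x y t, P x -> P y -> R x t -> R y t -> rel x y) -> finite_upto P rel.
Proof.
move=> Rex Rrel.
have [s [sP sR]] : exists s : seq E, (forall y, y \in s -> P y) /\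
    forall x t, P x -> t \in enum T -> R x t -> exists2 y, y \in s & rel x y.
  elim: (enum T) => [|t ts [s [sP sR]]]; first by exists [::].
  have [[x0 [Px0 Rx0]]|nx] := classic (exists x, P x /\ R x t).
    exists (x0 :: s); split=> [y|x u Px]; first by rewrite inE => /orP[/eqP ->|/sP].
    rewrite inE => /orP[/eqP ->|ut] Rxu; first by exists x0; rewrite ?mem_head //; apply: Rrel Rx0.
    by have [y ys xy] := sR x u Px ut Rxu; exists y; rewrite // inE ys orbT.
  exists s; split=> // x u Px; rewrite inE => /orP[/eqP -> Rxt|]; last exact: sR.
  by case: nx; exists x.
exists s; split=> // x Px; have [t Rxt] := Rex x Px.
by apply: sR Rxt; rewrite // mem_enum.
Qed.

(** Allows counting in two stages: [rel1] will compare the middle systems, and the corner blocks are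
    then classified next to a fixed representative [y]. *)
Lemma finite_upto_refine P rel1 rel : finite_upto P rel1 ->
  (forall y, P y -> finite_upto (fun x => P x /\ rel1 x y) rel) -> finite_upto P rel.
Proof.
move=> [s [sP sR]] fin.
have [s' [sP' sR']] : exists s' : seq E, (forall y, y \in s' -> P y) /\
    forall x y, P x -> y \in s -> rel1 x y -> exists2 z, z \in s' & rel x z.
  elim: s {sR} sP => [|y s IH] sP; first by exists [::].
  have [s1 [s1P s1R]] := IH (fun z zs => sP z (mem_behead (s := y :: s) zs)).
  have [s2 [s2P s2R]] := fin y (sP y (mem_head _ _)).
  exists (s2 ++ s1); split=> [z|x z Px].
    by rewrite mem_cat => /orP[/s2P[]|/s1P].
  rewrite inE => /orP[/eqP -> xy|zs xz].
    by have [w w2 xw] := s2R x (conj Px xy); exists w; rewrite // mem_cat w2.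
  by have [w w1 xw] := s1R x z Px zs xz; exists w; rewrite // mem_cat w1 orbT.
by exists s'; split=> // x Px; have [y ys xy] := sR x Px; apply: sR' xy.
Qed.
End FiniteUpTo.

Section Parabolic.
Variables (k : fieldType) (n : nat) (lev : 'I_n -> nat).
Implicit Types g h X Y : 'M[k]_n.

Definition upper g := forall i j, (lev j < lev i)%N -> g i j = 0.

Definition upper_conj X Y :=
  exists g, [/\ g \in unitmx, upper g & g *m X = Y *m g].

Lemma upper_mul g h : upper g -> upper h -> upper (g *m h).
Proof.
move=> ug uh i j ij; rewrite mxE big1 // => l _.
have [il|li] := leqP (lev i) (lev l); last by rewrite ug ?mul0r.
by rewrite uh ?mulr0 // (leq_trans ij).
Qed.

(* The row space spanned by the unit rows of level at least m is g-stable, hence g^-1-stable. *)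
Lemma upper_inv g : g \in unitmx -> upper g -> upper (invmx g).
Proof.
move=> gU ug i j ij.
pose D : 'M[k]_n := \matrix_(i', j') ((i' == j') && (lev i <= lev i')%N)%:R.
have DE (B : 'M[k]_n) a b : (D *m B) a b = if (lev i <= lev a)%N then B a b else 0.
  rewrite mxE (bigD1 a) //= mxE eqxx big1 ?addr0; last first.
    by move=> c ca; rewrite mxE eq_sym (negPf ca) mul0r.
  by case: ifP => _; rewrite ?mul1r ?mul0r.
have DgD : (D *m g *m D = D *m g)%R.
  apply/matrixP=> a b; rewrite mxE (bigD1 b) //= [D b b]mxE eqxx big1 ?addr0; last first.
    by move=> c cb; rewrite [D c b]mxE (negPf cb) mulr0.
  rewrite DE /=; case: (leqP (lev i) (lev b)) => [_|bi]; first by rewrite mulr1.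
  by rewrite mulr0; case: ifP => // ia; rewrite ug // (leq_trans bi).
have sub : (D *m g <= D)%MS by rewrite -DgD submxMl.
have rk : \rank (D *m g) = \rank D by rewrite mxrankMfree // row_free_unit.
have /submxP[Z DZ] : (D <= D *m g)%MS.
  by have := mxrank_leqif_sup sub; rewrite rk => -[_ /esym ->].
have := DE (invmx g) i j; rewrite leqnn => <-.
rewrite DZ -mulmxA mulmxK // mxE big1 // => l _.
by rewrite mxE; case: eqVneq => [->|_] /=; rewrite ?mulr0 // leqNgt ij mulr0.
Qed.

Lemma upper_conj_sym X Y : upper_conj X Y -> upper_conj Y X.
Proof.
move=> [g [gU ug e]]; exists (invmx g); split; rewrite ?unitmx_inv //.
  exact: upper_inv.
by rewrite -[LHS](mulmxK gU) -(mulmxA _ Y) -e mulKmx.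
Qed.

Lemma upper_conj_trans X Y Z : upper_conj X Y -> upper_conj Y Z -> upper_conj X Z.
Proof.
move=> [g [gU ug e]] [h [hU uh e']]; exists (h *m g); split.
- by rewrite unitmx_mul hU.
- exact: upper_mul.
by rewrite -mulmxA e !mulmxA e'.
Qed.

End Parabolic.

(** * Flagged blocks of a strictly block triangular matrix *)
Section Coordinates.
Variables (k : fieldType) (n : nat).
Local Notation vT := ('cV[k]_n).

Definition coord_proj (P : pred 'I_n) (v : vT) : vT := \col_i (if P i then v i 0 else 0).

Fact coord_proj_linear P : linear (coord_proj P).
Proof.
move=> c u v; apply/colP=> i; rewrite !mxE; case: (P i) => //.
by rewrite mulr0 addr0.
Qed.

HB.instance Definition _ P :=
  GRing.isLinear.Build k vT vT _ (coord_proj P) (coord_proj_linear P).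

Definition cproj P : 'End(vT) := linfun (coord_proj P).
Definition cspace (P : pred 'I_n) : {vspace vT} := lker (cproj (predC P)).
Definition mxfun (X : 'M[k]_n) : 'End(vT) := linfun (mulmx X).

Lemma cprojE (P : pred _) (v : vT) i : cproj P v i 0 = if P i then v i 0 else 0.
Proof. by rewrite lfunE mxE. Qed.

Lemma mxfunE X (v : vT) : mxfun X v = X *m v. Proof. by rewrite lfunE. Qed.

Lemma cspaceP P (v : vT) : reflect (forall i, ~~ P i -> v i 0 = 0) (v \in cspace P).
Proof.
rewrite memv_ker; apply: (iffP eqP) => [e i Pi|h].
  by have := congr1 (fun w : vT => w i 0) e; rewrite cprojE /= Pi mxE.
by apply/colP=> i; rewrite cprojE mxE /=; case: ifP => // /h.
Qed.

Lemma cspaceS P Q : subpred P Q -> (cspace P <= cspace Q)%VS.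
Proof.
move=> PQ; apply/subvP=> v /cspaceP h; apply/cspaceP=> i Qi; apply: h.
by apply: contra Qi => /PQ.
Qed.

Lemma cproj_mem P (v : vT) : cproj P v \in cspace P.
Proof. by apply/cspaceP=> i /negPf Pi; rewrite cprojE Pi. Qed.

Lemma cproj_id P (v : vT) : v \in cspace P -> cproj P v = v.
Proof. by move/cspaceP=> h; apply/colP=> i; rewrite cprojE; case: ifP => // /negbT/h. Qed.

Lemma cproj0 (P Q : pred _) (v : vT) : (forall i, P i -> ~~ Q i) -> v \in cspace P -> cproj Q v = 0.
Proof.
move=> PQ /cspaceP h; apply/colP=> i; rewrite cprojE mxE; case: ifP => // Qi.
by apply: h; apply: contraL Qi => /PQ.
Qed.

Lemma lfun_matrix (G : 'End(vT)) : exists M : 'M[k]_n, forall v, M *m v = G v.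
Proof.
exists (\matrix_(i, j) G (delta_mx j 0) i 0) => v.
have -> : v = \sum_j v j 0 *: delta_mx j 0.
  by rewrite {1}(matrix_sum_delta v); apply: eq_bigr => j _; rewrite big_ord1.
rewrite mulmx_sumr linear_sum; apply: eq_bigr => j _; rewrite -scalemxAr linearZ.
by congr (_ *: _); apply/colP=> i; rewrite -colE !mxE.
Qed.

Lemma unitmx_inj (M : 'M[k]_n) : (forall v : vT, M *m v = 0 -> v = 0) -> M \in unitmx.
Proof.
move=> h; rewrite -unitmx_tr unitmxE unitfE; apply/negP=> /det0P[v v0 vM].
case/negP: v0; apply/eqP/trmx_inj; rewrite trmx0; apply: h.
by rewrite -[M]trmxK -trmx_mul vM trmx0.
Qed.

End Coordinates.

Section Orbits.
Variables (k : fieldType) (n : nat) (lev : 'I_n -> nat) (a0 a1 a2 : nat).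
Hypothesis lev_lt : forall i, (lev i < a0 + a1 + a2)%N.
Local Notation vT := ('cV[k]_n).
Implicit Types (X : 'M[k]_n).

(* Indices are shifted by one: [piece 0], [piece 1], [piece 2] below are W1, W2, W3, and
   [flag c] is the chain that the parabolic subgroup stabilizes in [piece c]. *)
Definition coarse i := ((a0 <= lev i) + (a0 + a1 <= lev i))%N.
Definition base (c : nat) := match c with 0 => 0%N | 1 => a0 | _ => (a0 + a1)%N end.
Definition width (c : nat) := match c with 0 => a0 | 1 => a1 | _ => a2 end.

Definition flag c j : {vspace vT} :=
  cspace k (fun i => (coarse i == c) && (lev i < base c + j)%N).
Definition piece c : {vspace vT} := cspace k (fun i => coarse i == c).
Definition proj c : 'End(vT) := cproj k (fun i => coarse i == c).

Definition block_nilp X := forall i j, ~~ (coarse i < coarse j)%N -> X i j = 0.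

Lemma base_le i : (base (coarse i) <= lev i)%N.
Proof.
rewrite /coarse; case: (leqP a0 (lev i)) => h0; case: (leqP (a0 + a1) (lev i)) => h1 //=.
by move: (leq_trans h1 (ltnW h0)); lia.
Qed.

Lemma flag_chain c : chain (flag c).
Proof.
split=> [|j].
  apply/eqP; rewrite -subv0; apply/subvP=> v /cspaceP h; rewrite memv0; apply/eqP/colP=> i.
  rewrite mxE h // /coarse /base; clear h; case: c => [|[|[|c]]]; lia.
by apply: cspaceS => i /andP[-> h]; rewrite addnS leqW.
Qed.

Lemma flag_full c j : (width c <= j)%N -> flag c j = piece c.
Proof.
move=> cj; apply/eqP; rewrite eqEsubv; apply/andP; split; apply: cspaceS => i; first by case/andP.
move=> /eqP e; rewrite e eqxx /=; have := lev_lt i; move: cj e.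
by rewrite /coarse /base /width; case: c => [|[|[|c]]]; lia.
Qed.

Lemma flag_sub c j : (flag c j <= piece c)%VS.
Proof. by apply: cspaceS => i /andP[]. Qed.

Lemma proj_mem c (v : vT) : proj c v \in piece c. Proof. exact: cproj_mem. Qed.

Lemma proj_id c (v : vT) : v \in piece c -> proj c v = v. Proof. exact: cproj_id. Qed.

Lemma proj0 c c' (v : vT) : c != c' -> v \in piece c -> proj c' v = 0.
Proof. by move=> cc'; apply: cproj0 => i /eqP ->. Qed.

Lemma proj_sum (v : vT) : v = proj 0 v + proj 1 v + proj 2 v.
Proof.
apply/colP=> i; rewrite !mxE !cprojE.
have : (coarse i <= 2)%N by rewrite /coarse; lia.
by case: (coarse i) => [|[|[|]]] //= _; rewrite ?addr0 ?add0r.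
Qed.

Lemma nilp0 X (v : vT) : block_nilp X -> v \in piece 0 -> X *m v = 0.
Proof.
move=> nX /cspaceP h; apply/colP=> i; rewrite !mxE big1 // => j _.
have [e|e] := eqVneq (coarse j) 0%N; last by rewrite h ?mulr0.
by rewrite nX ?mul0r // e.
Qed.

Lemma nilp1 X (v : vT) : block_nilp X -> v \in piece 1 -> X *m v \in piece 0.
Proof.
move=> nX /cspaceP h; apply/cspaceP=> i i0; rewrite !mxE big1 // => j _.
have [e|e] := eqVneq (coarse j) 1%N; last by rewrite h ?mulr0.
by rewrite nX ?mul0r // e ltnS leqn0.
Qed.

Lemma nilp2 X (v : vT) : block_nilp X -> proj 2 (X *m v) = 0.
Proof.
move=> nX; apply/colP=> i; rewrite cprojE !mxE; case: eqP => // ei.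
rewrite big1 // => j _; rewrite nX ?mul0r // ei -leqNgt /coarse.
lia.
Qed.

Lemma nilp_split X (v : vT) : block_nilp X -> X *m v = proj 0 (X *m v) + proj 1 (X *m v).
Proof. by move=> nX; rewrite {1}[X *m v]proj_sum nilp2 // addr0. Qed.

Lemma block_nilp_conj X X' : block_nilp X -> upper_conj lev X X' -> block_nilp X'.
Proof.
move=> nX [g [gU ug e]].
have -> : X' = g *m X *m invmx g by rewrite e mulmxK.
have ugV := upper_inv gU ug.
have mono i j : (lev i <= lev j)%N -> (coarse i <= coarse j)%N by rewrite /coarse; lia.
move=> i j; rewrite -leqNgt => ji; rewrite mxE big1 // => l _.
have [lj|jl] := leqP (lev l) (lev j); last by rewrite ugV ?mulr0.
rewrite [(g *m X) i l]mxE big1 ?mul0r // => m _.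
have [im|mi] := leqP (lev i) (lev m); last by rewrite ug ?mul0r.
by rewrite nX ?mulr0 // -leqNgt (leq_trans (mono _ _ lj)) // (leq_trans ji) // mono.
Qed.

(** * Block triangular conjugators assembled from maps between the pieces *)

Section Build.
Variables (g : nat -> 'End(vT)) (y z : 'End(vT)).
Hypothesis gF : forall c j, (c < 3)%N -> (g c @: flag c j = flag c j)%VS.
Hypothesis gI : forall c, (c < 3)%N -> {in piece c, forall v, g c v = 0 -> v = 0}.
Hypothesis yW : {in piece 1, forall v, y v \in piece 0}.
Hypothesis zW : {in piece 2, forall v, z v \in piece 1}.

(** There is no component from [piece 2] to [piece 0]: such a map has zero product on either side
    with every [block_nilp] matrix, so it does not affect conjugation. *)
Definition assemble : 'End(vT) :=
  ((g 0%N \o proj 0) + ((g 1%N + y) \o proj 1) + ((g 2%N + z) \o proj 2))%VF.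

Lemma assembleE v :
  assemble v = g 0%N (proj 0 v) + (g 1%N (proj 1 v) + y (proj 1 v))
    + (g 2%N (proj 2 v) + z (proj 2 v)).
Proof. by rewrite /assemble !add_lfunE !comp_lfunE !add_lfunE. Qed.

Lemma build_mem c v : (c < 3)%N -> v \in piece c -> g c v \in piece c.
Proof. by move=> c3 vW; rewrite -(flag_full (leqnn (width c))) -gF // flag_full // memv_img. Qed.

Lemma assemble0 v : v \in piece 0 -> assemble v = g 0%N v.
Proof.
by move=> vW; rewrite assembleE proj_id // !(@proj0 0 _ v) // !linear0 !addr0.
Qed.

Lemma assemble1 v : v \in piece 1 -> assemble v = g 1%N v + y v.
Proof.
by move=> vW; rewrite assembleE (@proj_id 1) // !(@proj0 1 _ v) // !linear0 !addr0 add0r.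
Qed.

Lemma assemble2 v : v \in piece 2 -> assemble v = g 2%N v + z v.
Proof.
by move=> vW; rewrite assembleE (@proj_id 2) // !(@proj0 2 _ v) // !linear0 !addr0 add0r.
Qed.

Lemma assemble_inj v : assemble v = 0 -> v = 0.
Proof.
rewrite assembleE => e.
have gW c : (c < 3)%N -> g c (proj c v) \in piece c by move=> c3; rewrite build_mem ?proj_mem.
have yv : y (proj 1 v) \in piece 0 by rewrite yW ?proj_mem.
have zv : z (proj 2 v) \in piece 1 by rewrite zW ?proj_mem.
have p2 : proj 2 v = 0.
  apply: (gI _ (proj_mem 2 v)) => //; have := congr1 (proj 2) e.
  rewrite linear0 !linearD /= (proj_id (gW 2 isT)) (proj0 _ (gW 0%N isT)) //.
  by rewrite (proj0 _ (gW 1%N isT)) // (proj0 _ yv) // (proj0 _ zv) // !add0r addr0.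
move: e; rewrite p2 !linear0 !addr0 => e.
have p1 : proj 1 v = 0.
  apply: (gI _ (proj_mem 1 v)) => //; have := congr1 (proj 1) e.
  rewrite linear0 !linearD /= (proj_id (gW 1%N isT)) (proj0 _ (gW 0%N isT)) //.
  by rewrite (proj0 _ yv) // add0r addr0.
move: e; rewrite p1 !linear0 !addr0 => e.
by rewrite [v]proj_sum p1 p2 !addr0; apply: gI e => //; apply: proj_mem.
Qed.

Lemma unit_col_flag j : (delta_mx j 0 : vT) \in flag (coarse j) (lev j - base (coarse j)).+1.
Proof.
apply/cspaceP=> i; rewrite mxE eqxx andbT; case: (eqVneq i j) => [->|//].
by rewrite eqxx /=; lia.
Qed.

Lemma assemble_upper (M : 'M[k]_n) : (forall v : vT, M *m v = assemble v) -> upper lev M.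
Proof.
move=> ME i j ij.
have -> : M i j = (assemble (delta_mx j 0)) i 0 by rewrite -ME -colE !mxE.
have dF := unit_col_flag j; have dW := subvP (flag_sub _ _) _ dF.
have c3 : (coarse j < 3)%N by rewrite /coarse; lia.
have gi : (g (coarse j) (delta_mx j 0)) i 0 = 0.
  have : g (coarse j) (delta_mx j 0) \in flag (coarse j) (lev j - base (coarse j)).+1.
    by rewrite -[flag _ _](gF _ c3) memv_img.
  by move=> /cspaceP; apply; rewrite negb_and -leqNgt; have := base_le j; lia.
have yi (w : vT) : w \in piece (coarse j).-1 -> (0 < coarse j)%N -> w i 0 = 0.
  move=> /cspaceP h j0; apply: h; apply/negP => /eqP.
  by move: ij j0; rewrite /coarse; lia.
move: gi dW yi; case: (coarse j) c3 => [|[|[|//]]] _ gi dW yi.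
- by rewrite assemble0.
- by rewrite assemble1 // mxE gi add0r yi // yW.
- by rewrite assemble2 // mxE gi add0r yi // zW.
Qed.

(** The three equations are the nonzero blocks of [M *m X = X' *m M]. Only the corner sees [y] and
    [z]: [y] corrects it by maps factoring through the lower block, [z] by maps into the image of
    the upper block. *)
Lemma assemble_conj X X' : block_nilp X -> block_nilp X' ->
  {in piece 1, forall v, g 0%N (X *m v) = X' *m g 1%N v} ->
  {in piece 2, forall v, g 1%N (proj 1 (X *m v)) = proj 1 (X' *m g 2%N v)} ->
  {in piece 2, forall v, g 0%N (proj 0 (X *m v)) + y (proj 1 (X *m v))
     = proj 0 (X' *m g 2%N v) + X' *m z v} ->
  upper_conj lev X X'.
Proof.
move=> nX nX' e1 e21 e20; have [M ME] := lfun_matrix assemble.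
exists M; split; last first.
- suff e v : M *m (X *m v) = X' *m (M *m v) :> vT.
    apply/matrixP=> i j; have := e (delta_mx j 0); rewrite !mulmxA -!colE => /colP/(_ i).
    by rewrite !mxE.
  rewrite !ME [v]proj_sum !mulmxDr !linearD /= ?mulmxDr; congr (_ + _ + _).
  + by rewrite nilp0 ?proj_mem // linear0 assemble0 ?nilp0 ?build_mem ?proj_mem.
  + have W1 := proj_mem 1 v; rewrite assemble0 ?nilp1 // assemble1 // mulmxDr -e1 //.
    by rewrite (nilp0 _ (yW W1)) ?addr0.
  have W2 := proj_mem 2 v; rewrite [X *m _]nilp_split // linearD /=.
  rewrite assemble0 ?proj_mem // assemble1 ?proj_mem // assemble2 // mulmxDr.
  by rewrite [X' *m g _ _]nilp_split // addrCA e20 // e21 // addrCA addrA.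
- exact: assemble_upper.
by apply: unitmx_inj => v; rewrite ME; apply: assemble_inj.
Qed.
End Build.
End Orbits.

(** * Transport of the two off-diagonal blocks *)
Definition arms (q0 q1 q2 : nat) (a : 'I_3) : nat := nth 0%N [:: q0; q1; q2] a.

Lemma slope_arms q0 q1 q2 : slope (arms q0 q1 q2) = q0%:R^-1 + q1%:R^-1 + q2%:R^-1.
Proof. by rewrite /slope !big_ord_recl big_ord0 addr0 addrA. Qed.

Lemma arms_gt0 q0 q1 q2 a : (0 < q0)%N -> (0 < q1)%N -> (0 < q2)%N -> (0 < arms q0 q1 q2 a)%N.
Proof. by case: a => [[|[|[|]]]]. Qed.

Definition three_chains (T : Type) (F0 F1 F2 : nat -> T) (a : 'I_3) : nat -> T :=
  match val a with 0 => F0 | 1 => F1 | _ => F2 end.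

Section Orbits.
Variables (k : fieldType) (n : nat) (lev : 'I_n -> nat) (a0 a1 a2 : nat).
Hypothesis lev_lt : forall i, (lev i < a0 + a1 + a2)%N.
Hypotheses (a0_gt0 : (0 < a0)%N) (a1_gt0 : (0 < a1)%N).
Local Notation vT := ('cV[k]_n).
Local Notation flag := (flag k lev a0 a1).
Local Notation piece := (piece k lev a0 a1).
Local Notation proj := (proj k lev a0 a1).
Local Notation block_nilp := (block_nilp lev a0 a1).
Implicit Types (X : 'M[k]_n).

(** The last image [C @: F m] may be smaller than [W], which is therefore appended at index
    [m.+1]. *)
Definition img_chain (C : 'End(vT)) (F : nat -> {vspace vT}) (W : {vspace vT}) m j :=
  if (j <= m)%N then (C @: F j)%VS else W.

Lemma img_chain_sys C F W m : chain F -> (C @: F m <= W)%VS ->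
  chain (img_chain C F W m) /\ forall j, (m.+1 <= j)%N -> img_chain C F W m j = W.
Proof.
move=> cF CW; split; last by move=> j; rewrite /img_chain ltnNge => /negPf ->.
split=> [|j]; first by rewrite /img_chain cF.1 limg0.
rewrite /img_chain; have [jm|] := leqP j.+1 m; first by rewrite ltnW // limgS // cF.2.
case: ifP => // jm _; apply: subv_trans CW; apply: limgS.
exact: chainS.
Qed.

(** The shift makes room for the kernel of [A] on [W], the preimage of [F 0], at index 1. *)
Definition preim_chain (A : 'End(vT)) (W : {vspace vT}) (F : nat -> {vspace vT}) j : {vspace vT} :=
  if j is j'.+1 then (W :&: A @^-1: F j')%VS else 0%VS.

Definition mid_map X : 'End(vT) := (proj 1 \o mxfun X)%VF.

Lemma mid_mapE X v : mid_map X v = proj 1 (X *m v).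
Proof. by rewrite comp_lfunE mxfunE. Qed.

Definition mid_chains X : 'I_3 -> nat -> {vspace vT} :=
  three_chains (flag 1%N) (img_chain (mid_map X) (flag 2%N) (piece 1%N) a2)
    (preim_chain (mxfun X) (piece 1%N) (flag 0%N)).

Lemma mid_sys X : block_nilp X -> star_sys (arms a1 a2.+1 a0.+1) (mid_chains X) (piece 1%N).
Proof.
move=> nX [[|[|[|//]]] c3]; rewrite /mid_chains /three_chains /arms /=.
- by split; [exact: flag_chain|move=> j jp; apply: (flag_full k lev_lt)].
- apply: img_chain_sys; first exact: flag_chain.
  by apply/subvP=> _ /memv_imgP[v _ ->]; rewrite mid_mapE proj_mem.
split; first split=> // [[|j]]; rewrite ?sub0v //.
  by apply: capvS => //; apply: lpreimS; apply: (flag_chain _ _ _ _ _).2.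
case=> [//|j] j0; apply/capv_idPl/subvP=> v vW.
by rewrite -memv_preim mxfunE (flag_full k lev_lt (c := 0)) //; apply: nilp1.
Qed.

(** An isomorphism [f] of the middle systems acts on [piece 1]. Equality of preimage chains extends
    it to [piece 0] by [chain_extend], equality of image chains lifts it to [piece 2] by
    [chain_lift]. The resulting block diagonal conjugation makes both blocks those of [X1] and
    leaves the corner arbitrary. *)
Lemma mid_transport X X1 : block_nilp X -> block_nilp X1 ->
  star_iso (mid_chains X) (piece 1%N) (mid_chains X1) (piece 1%N) ->
  exists X', [/\ block_nilp X', upper_conj lev X X',
    {in piece 1%N, forall v : vT, X' *m v = X1 *m v} &
    {in piece 2%N, forall v : vT, proj 1 (X' *m v) = proj 1 (X1 *m v)}].
Proof.
move=> nX nX1 [f [fU fW fI]].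
have fW1 v : v \in piece 1%N -> f v \in piece 1%N by move=> vW; rewrite -fW memv_img.
have [g0 [g0F g0I g0A]] : exists g : 'End(vT), [/\
    forall i, (i <= a0)%N -> (g @: flag 0%N i = flag 0%N i)%VS,
    {in flag 0%N a0, forall v, g v = 0 -> v = 0} &
    {in piece 1%N, forall w, mxfun X w \in flag 0%N a0 -> g (mxfun X w) = (mxfun X1 \o f)%VF w}].
  apply: chain_extend; first exact: flag_chain.
  move=> i i0; apply/vspaceP=> w; rewrite !memv_cap; case wW : (w \in piece 1%N) => //=.
  rewrite -!memv_preim comp_lfunE; have := fU ord_max i.+1; rewrite /mid_chains /three_chains /=.
  move=> e; apply/idP/idP => h.
    have : f w \in (piece 1%N :&: mxfun X1 @^-1: flag 0%N i)%VS.
      by rewrite -e memv_img // memv_cap wW -memv_preim.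
    by rewrite memv_cap -memv_preim => /andP[].
  have : f w \in (piece 1%N :&: mxfun X1 @^-1: flag 0%N i)%VS.
    by rewrite memv_cap -memv_preim h fW1.
  rewrite -e => /memv_imgP[w' /memv_capP[w'W]]; rewrite -memv_preim => Xw' fw.
  suff -> : w = w' by [].
  apply/eqP; rewrite -subr_eq0; apply/eqP; apply: fI; first by rewrite memvB.
  by rewrite linearB /= fw subrr.
have [g2 [g2F g2I g2C]] : exists g : 'End(vT), [/\
    forall i, (i <= a2)%N -> (g @: flag 2%N i = flag 2%N i)%VS,
    {in flag 2%N a2, forall v, g v = 0 -> v = 0} &
    {in flag 2%N a2, forall v, mid_map X1 (g v) = (f \o mid_map X)%VF v}].
  apply: chain_lift; first exact: flag_chain.
  move=> i i2; have := fU (@Ordinal 3 1 isT) i.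
  by rewrite /mid_chains /three_chains /img_chain /= i2 => e; rewrite limg_comp e.
have F0 : flag 0%N a0 = piece 0%N by apply: (flag_full k lev_lt).
have F2 : flag 2%N a2 = piece 2%N by apply: (flag_full k lev_lt).
rewrite {}F0 {}F2 in g0I g0A g2I g2C.
pose g c := match c with 0 => g0 | 1 => f | _ => g2 end.
have full c j (h : 'End(vT)) :
    (forall i, (i <= width a0 a1 a2 c)%N -> (h @: flag c i = flag c i)%VS) ->
    (h @: flag c j = flag c j)%VS.
  move=> hF; have [/hF//|/ltnW jc] := leqP j (width a0 a1 a2 c).
  by rewrite (flag_full k lev_lt jc) -(flag_full k lev_lt (leqnn _)) hF.
have gF c j : (c < 3)%N -> (g c @: flag c j = flag c j)%VS.
  case: c => [|[|[|//]]] _; [exact: full|exact: (fU ord0)|exact: full].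
have gI c : (c < 3)%N -> {in piece c, forall v, g c v = 0 -> v = 0}.
  by case: c => [|[|[|]]].
have z0 c c' : {in piece c, forall v : vT, (0 : 'End(vT)) v \in piece c'}.
  by move=> v _; rewrite zero_lfunE mem0v.
have [M ME] := lfun_matrix (assemble lev a0 a1 g 0 0).
have MU : M \in unitmx.
  by apply: unitmx_inj => v; rewrite ME; apply: assemble_inj.
have uM : upper lev M by apply: assemble_upper ME.
have MX : upper_conj lev X (M *m X *m invmx M) by exists M; rewrite mulmxKV.
have nX' := block_nilp_conj nX MX.
have eM v : (M *m X *m invmx M) *m (M *m v) = M *m (X *m v) :> vT.
  by rewrite !mulmxA mulmxKV.
exists (M *m X *m invmx M); split=> // v vW.
  move: (vW); rewrite -fW => /memv_imgP[w wW ->].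
  have <- : M *m w = f w by rewrite ME (assemble1 _ _ _ wW) zero_lfunE addr0.
  rewrite eM !ME assemble0 ?nilp1 // (assemble1 _ _ _ wW) zero_lfunE addr0 /=.
  by rewrite -mxfunE g0A // ?comp_lfunE ?mxfunE // nilp1.
have : v \in (g 2%N @: piece 2%N)%VS.
  have e := flag_full k lev_lt (leqnn (width a0 a1 a2 2)).
  by rewrite -e gF // e.
move=> /memv_imgP[w wW ->].
have <- : M *m w = g 2%N w by rewrite ME (assemble2 _ _ _ wW) zero_lfunE addr0.
rewrite eM !ME (assemble2 _ _ _ wW) zero_lfunE addr0 /= -mid_mapE g2C // comp_lfunE mid_mapE.
rewrite {1}[X *m w](nilp_split _ nX) linearD /= assemble0 ?proj_mem // assemble1 ?proj_mem //.
rewrite zero_lfunE addr0 !linearD /= (@proj0 _ _ _ _ _ 0 1) ?add0r //.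
  by apply: proj_id; apply: fW1; apply: proj_mem.
by apply: (build_mem lev_lt gF (c := 0%N)) => //; apply: proj_mem.
Qed.

End Orbits.

(** * The corner block *)
Section Orbits.
Variables (k : fieldType) (n : nat) (lev : 'I_n -> nat) (a0 a1 a2 : nat).
Hypothesis lev_lt : forall i, (lev i < a0 + a1 + a2)%N.
Hypotheses (a0_gt0 : (0 < a0)%N) (a1_gt0 : (0 < a1)%N).
Local Notation vT := ('cV[k]_n).
Local Notation flag := (flag k lev a0 a1).
Local Notation piece := (piece k lev a0 a1).
Local Notation proj := (proj k lev a0 a1).
Local Notation block_nilp := (block_nilp lev a0 a1).
Local Notation mid_map := (mid_map lev a0 a1).
Implicit Types (X : 'M[k]_n).

Section Corner.
Variable X1 : 'M[k]_n.
Hypothesis nX1 : block_nilp X1.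

(* [K] is the kernel of the lower block and [I] the image of the upper block; once these two
   blocks are fixed, the conjugacy class only depends on the map [K -> piece 0 / I] induced by
   the corner block, and the flagged complement [T] of [I] stands for the quotient. *)
Let K : {vspace vT} := (piece 2%N :&: lker (mid_map X1))%VS.
Let I : {vspace vT} := (mxfun X1 @: piece 1%N)%VS.

Variable T : {vspace vT}.
Hypotheses (TW : (T <= piece 0%N)%VS) (IT : (I :&: T = 0)%VS).
Hypothesis flagT : forall i, (i <= a0)%N -> (flag 0%N i <= flag 0%N i :&: I + flag 0%N i :&: T)%VS.

Definition same_blocks X :=
  {in piece 1%N, forall v : vT, X *m v = X1 *m v} /\
  {in piece 2%N, forall v : vT, proj 1 (X *m v) = proj 1 (X1 *m v)}.

Definition corner X : 'End(vT) := (daddv_pi T I \o proj 0 \o mxfun X)%VF.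

(** Only two chains carry data here; the third has length 1 and serves to fit the theory of three
    chains. *)
Definition corner_chains X : 'I_3 -> nat -> {vspace vT} :=
  three_chains (fun j => flag 0%N j :&: T)%VS
    (img_chain (corner X) (fun j => flag 2%N j :&: K)%VS T a2)
    (fun j => if j is 0 then 0%VS else T).

Lemma flag0_split j : (flag 0%N j = flag 0%N j :&: I + flag 0%N j :&: T)%VS.
Proof.
apply/eqP; rewrite eqEsubv subv_add !capvSl !andbT.
have [/flagT//|/ltnW j0] := leqP j a0.
by rewrite (flag_full k lev_lt (c := 0%N) j0) -(flag_full k lev_lt (c := 0%N) (leqnn _)) flagT.
Qed.

Lemma corner_sys X : star_sys (arms a0 a2.+1 1) (corner_chains X) T.
Proof.
case=> [[|[|[|//]]] c3]; rewrite /corner_chains /three_chains /arms /=.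
- split; first exact/capv_chain/flag_chain.
  by move=> j j0; rewrite (flag_full k lev_lt (c := 0%N) j0); apply/capv_idPr.
- apply: img_chain_sys; first exact/capv_chain/flag_chain.
  by apply/subvP=> _ /memv_imgP[v _ ->]; rewrite !comp_lfunE memv_pi.
by split; [split=> // -[|j]; rewrite ?sub0v|case].
Qed.

(** The conjugator is the identity on [I], on [piece 1] and on a flagged complement [S] of [K], it
    is [f] on [T] and a lift [h] of [f] on [K]. Being trivial on [I] and preserving [K], it respects
    the two fixed blocks, so only the corner remains to be corrected. *)
Lemma corner_conj X X' : block_nilp X -> block_nilp X' -> same_blocks X -> same_blocks X' ->
  star_iso (corner_chains X) T (corner_chains X') T -> upper_conj lev X X'.
Proof.
move=> nX nX' [X1A X1C] [X'1A X'1C] [f [fU fT fI]].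
have IW : (I <= piece 0%N)%VS by apply/subvP=> _ /memv_imgP[v vW ->]; rewrite mxfunE nilp1.
have KW : (K <= piece 2%N)%VS by apply: capvSl.
have F0 : flag 0%N a0 = piece 0%N by apply: (flag_full k lev_lt (c := 0%N)).
have F2 : flag 2%N a2 = piece 2%N by apply: (flag_full k lev_lt (c := 2%N)).
have TI : (T :&: I = 0)%VS by rewrite capvC.
have WIT : (I + T = piece 0%N)%VS.
  by rewrite -F0 flag0_split F0 (capv_idPr IW) (capv_idPr TW).
have rhoD w : w \in piece 0%N -> daddv_pi I T w + daddv_pi T I w = w.
  by move=> wW; apply: daddv_pi_add; rewrite // WIT.
have [h [hF hI hC]] : exists h : 'End(vT), [/\
    forall i, (i <= a2)%N -> (h @: (flag 2%N i :&: K) = flag 2%N i :&: K)%VS,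
    {in (flag 2%N a2 :&: K)%VS, forall v, h v = 0 -> v = 0} &
    {in (flag 2%N a2 :&: K)%VS, forall v, corner X' (h v) = (f \o corner X)%VF v}].
  apply: chain_lift; first exact/capv_chain/flag_chain.
  move=> i i2; have := fU (@Ordinal 3 1 isT) i.
  by rewrite /corner_chains /three_chains /img_chain /= i2 => e; rewrite limg_comp e.
rewrite F2 (capv_idPr KW) in hI hC.
have hK v : v \in K -> h v \in K.
  by move=> vK; have := hF a2 (leqnn _); rewrite F2 (capv_idPr KW) => <-; rewrite memv_img.
have [S [SW KS FS]] := chain_complement K a2 (flag_chain k lev a0 a1 2%N).
rewrite F2 in SW.
have flagS j : (flag 2%N j = flag 2%N j :&: K + flag 2%N j :&: S)%VS.
  apply/eqP; rewrite eqEsubv subv_add !capvSl !andbT.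
  have [/FS//|/ltnW j2] := leqP j a2.
  by rewrite (flag_full k lev_lt (c := 2%N) j2) -F2 FS.
have WKS : (K + S = piece 2%N)%VS.
  by rewrite -F2 flagS F2 (capv_idPr KW) (capv_idPr SW).
have [g0 [g0I g0T]] := lfun_glue \1%VF f IT.
have [g2 [g2K g2S]] := lfun_glue h \1%VF KS.
have K0 v : v \in K -> proj 1 (X1 *m v) = 0.
  by move=> /memv_capP[_]; rewrite memv_ker mid_mapE => /eqP.
have [s [sW sA]] := lfun_section (mxfun X1) (piece 1%N).
have [r [rS rC]] := lfun_section (mid_map X1) S.
have [b bE] : exists b : 'End(vT), forall v, b v = proj 0 (X *m v).
  by exists (proj 0 \o mxfun X)%VF => v; rewrite comp_lfunE mxfunE.
have [b' bE'] : exists b : 'End(vT), forall v, b v = proj 0 (X' *m v).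
  by exists (proj 0 \o mxfun X')%VF => v; rewrite comp_lfunE mxfunE.
(* On [K] the components along [T] already agree by the choice of [h]; the discrepancy along [I] is
   lifted through the upper block and becomes [z]. *)
pose z1 := (s \o (daddv_pi I T \o (b - (b' \o h))))%VF.
have [z [zK zS]] := lfun_glue z1 0 KS.
(* On [S] the lower block is injective with inverse [r], so any discrepancy of the corner factors
   through it and is absorbed by [y]. *)
pose y := ((b' - (g0 \o b)) \o r \o proj 1)%VF.
have fTin v : v \in T -> f v \in T by move=> vT'; rewrite -fT memv_img.
have g0W v : v \in piece 0%N -> g0 v \in piece 0%N.
  rewrite -WIT => /memv_addP[u uI [t tT ->]]; rewrite linearD /= g0I // g0T // id_lfunE.
  by rewrite memv_add // fTin.
pose g c := match c with 0 => g0 | 1 => \1%VF | _ => g2 end.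
have gF c j : (c < 3)%N -> (g c @: flag c j = flag c j)%VS.
  case: c => [|[|[|//]]] _ /=; last first.
  - rewrite flagS limgD; congr (_ + _)%VS.
      rewrite (eq_in_limg (g := h)); last by move=> v /memv_capP[_]; apply: g2K.
      have [/hF//|/ltnW j2] := leqP j a2.
      by rewrite (flag_full k lev_lt (c := 2%N) j2) -F2 hF.
    rewrite (eq_in_limg (g := \1%VF)) ?lim1g //.
    by move=> v /memv_capP[_]; apply: g2S.
  - by rewrite lim1g.
  rewrite flag0_split limgD; congr (_ + _)%VS.
    rewrite (eq_in_limg (g := \1%VF)) ?lim1g //.
    by move=> v /memv_capP[_]; apply: g0I.
  rewrite (eq_in_limg (g := f)); last by move=> v /memv_capP[_]; apply: g0T.
  exact: (fU ord0).
have gI c : (c < 3)%N -> {in piece c, forall v, g c v = 0 -> v = 0}.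
  move=> c3; have e := flag_full k lev_lt (leqnn (width a0 a1 a2 c)).
  by apply: (lfun_inj_dim (f := g c)); rewrite -e (gF _ _ c3).
have bW v : b v \in piece 0%N by rewrite bE proj_mem.
have bW' v : b' v \in piece 0%N by rewrite bE' proj_mem.
have yW : {in piece 1%N, forall v, y v \in piece 0%N}.
  move=> v _; rewrite /y !comp_lfunE add_lfunE opp_lfunE memvB //.
  by rewrite comp_lfunE g0W.
have zW : {in piece 2%N, forall v, z v \in piece 1%N}.
  move=> v; rewrite -WKS => /memv_addP[u uK [t tS ->]].
  by rewrite linearD /= zK // zS // zero_lfunE addr0 comp_lfunE sW.
apply: (assemble_conj lev_lt gF gI yW zW nX nX').
- move=> v vW; rewrite /= id_lfunE X1A // X'1A // g0I ?id_lfunE //.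
  by rewrite -mxfunE memv_img.
- move=> v vW; rewrite /= id_lfunE; move: vW (vW); rewrite -{1}WKS => /memv_addP[u uK [t tS ->]] vW.
  have uW := subvP KW u uK; have tW := subvP SW t tS.
  have -> : g2 (u + t) = h u + t by rewrite linearD /= g2K // g2S // id_lfunE.
  rewrite !mulmxDr !linearD /= !X1C // !X'1C //.
    by rewrite (K0 u) // (K0 (h u)) ?hK.
  exact: (subvP KW _ (hK _ uK)).
have zero0 : {in S, forall t, z t = 0} by move=> t tS; rewrite zS // zero_lfunE.
have eqK u : u \in K -> g0 (proj 0 (X *m u)) + y (proj 1 (X *m u))
    = proj 0 (X' *m g2 u) + X' *m z u.
  move=> uK; have uW := subvP KW u uK.
  rewrite X1C // K0 // linear0 addr0 g2K // (X'1A (z u)) ?zW // zK // /z1 !comp_lfunE.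
  have iI : daddv_pi I T ((b - (b' \o h)%VF) u) \in I by apply: memv_pi.
  rewrite -(mxfunE X1) sA //.
  rewrite -bE -bE' add_lfunE opp_lfunE comp_lfunE linearB /=.
  rewrite -{1}(rhoD (b u)) // linearD /= g0I ?memv_pi // id_lfunE g0T ?memv_pi //.
  rewrite -{1}(rhoD (b' (h u))) // [X in _ = X]addrC -!addrA; congr (_ + _).
  have := hC u uK; rewrite !comp_lfunE !mxfunE -bE -bE' => e.
  by rewrite addKr e.
have eqS t : t \in S -> g0 (proj 0 (X *m t)) + y (proj 1 (X *m t))
    = proj 0 (X' *m g2 t) + X' *m z t.
  move=> tS; have tW := subvP SW t tS.
  rewrite zero0 // mulmx0 addr0 g2S // id_lfunE X1C //.
  have rt : r (proj 1 (X1 *m t)) = t.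
    apply/eqP; rewrite -subr_eq0; apply/eqP; apply: ((capv0P _ _).2 KS).
      apply/memv_capP; split; first by rewrite memvB // (subvP SW).
      by rewrite memv_ker linearB /= -(mid_mapE lev a0 a1 X1 t) rC ?subrr ?memv_img.
    by rewrite memvB.
  rewrite /y !comp_lfunE (proj_id (proj_mem _ _ _ _ _)) rt add_lfunE opp_lfunE comp_lfunE.
  by rewrite -bE -bE' addrC subrK.
move=> v; rewrite -WKS => /memv_addP[u uK [t tS ->]].
rewrite /= !mulmxDr !linearD /= ?mulmxDr ?linearD /=.
by rewrite addrACA eqK // eqS // addrACA.
Qed.
End Corner.

Lemma dim_column (V : {vspace vT}) : (\dim V <= n)%N.
Proof.
apply: leq_trans (dimvS (subvf V)) _; rewrite dimvf dim_matrix. lia.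
Qed.

(** The hypothesis is the slope condition for the middle system. For the corner, the trivial arm
    contributes 1 and the other two make the slope exceed it. *)
Lemma finite_conj : 1 < a0.+1%:R^-1 + a1%:R^-1 + a2.+1%:R^-1 :> rat ->
  finite_upto block_nilp (@upper_conj k n lev).
Proof.
move=> dynkin.
have mid_gt0 a : (0 < arms a1 a2.+1 a0.+1 a)%N by apply: arms_gt0.
have mid_dynkin : 1 < slope (arms a1 a2.+1 a0.+1) by rewrite slope_arms addrC addrA.
have [T [R [Rex Riso]]] := star_finite k mid_gt0 mid_dynkin n.
pose midR X t := R vT (mid_chains lev a0 a1 a2 X) (piece 1%N) t.
pose mid_iso X X1 := star_iso (mid_chains lev a0 a1 a2 X) (piece 1%N)
  (mid_chains lev a0 a1 a2 X1) (piece 1%N).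
apply: (finite_upto_refine (rel1 := mid_iso)).
  apply: (finite_upto_label (R := midR)) => [X nX|X Y t nX nY].
    by apply: Rex; [apply: mid_sys|apply: dim_column].
  by apply: Riso; rewrite ?dim_column //; apply: mid_sys.
move=> X1 nX1.
have cor_gt0 a : (0 < arms a0 a2.+1 1 a)%N by apply: arms_gt0.
have cor_dynkin : 1 < slope (arms a0 a2.+1 1).
  rewrite slope_arms invr1 ltrDr addr_gt0 // invr_gt0 ltr0n //.
have [T' [R' [R'ex R'iso]]] := star_finite k cor_gt0 cor_dynkin n.
have [Z [ZW IZ FZ]] := chain_complement (mxfun X1 @: piece 1%N)%VS a0 (flag_chain k lev a0 a1 0%N).
have ZW0 : (Z <= piece 0%N)%VS by rewrite -(flag_full k lev_lt (c := 0%N) (leqnn a0)).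
(* The label is read off a conjugate that already has the two blocks of [X1], as [corner_conj]
   requires. *)
pose corR X t := exists X', [/\ block_nilp X', upper_conj lev X X', same_blocks X1 X' &
  R' vT (corner_chains X1 Z X') Z t].
apply: (finite_upto_label (R := corR)) => [X [nX mX]|X Y t [nX _] [nY _]].
  have [X' [nX' XX' X'A X'C]] := mid_transport lev_lt nX nX1 mX.
  have [t Xt] := R'ex _ _ _ (corner_sys X1 ZW0 X') (dim_column Z).
  by exists t, X'.
move=> [X' [nX' XX' bX' Xt]] [Y' [nY' YY' bY' Yt]].
apply: upper_conj_trans XX' _; apply: upper_conj_trans (upper_conj_sym YY').
apply: (corner_conj nX1 ZW0 IZ FZ nX' nY' bX' bY').
by apply: R'iso Xt Yt; rewrite ?dim_column //; apply: corner_sys.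
Qed.
End Orbits.

(** * Block indices and finiteness of orbits *)
Section Blocks.
Implicit Types (d : seq nat) (a : nat * nat * nat).

Lemma esum_mono d i j : (i <= j)%N -> (esum d i <= esum d j)%N.
Proof.
move=> /subnKC <-; elim: (j - i)%N => [|m IH]; first by rewrite addn0.
apply: leq_trans IH _; rewrite addnS /esum.
have [h|h] := ltnP (i + m) (size d); first by rewrite (take_nth 0%N h) sumn_rcons leq_addr.
by rewrite !take_oversize // leqW.
Qed.

Lemma count_iota_prefix (P : pred nat) m b : (forall i j, (i <= j)%N -> P j -> P i) ->
  (b < m)%N -> (b < count P (iota 0 m))%N = P b.
Proof.
move=> Pdown; elim: m => // m IH; rewrite ltnS.
have -> : iota 0 m.+1 = iota 0 m ++ [:: m] by rewrite -addn1 iotaD.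
rewrite count_cat /= addn0.
case Pm: (P m) => bm.
  have cm : count P (iota 0 m) = m.
    rewrite -[RHS](size_iota 0); apply/eqP; rewrite -all_count; apply/allP=> i.
    by rewrite mem_iota => /andP[_ /ltnW im]; apply: Pdown Pm.
  by rewrite cm addn1 ltnS bm (Pdown b m).
rewrite addn0; move: bm; rewrite leq_eqVlt => /orP[/eqP ->|/IH //].
by rewrite Pm; apply/negbTE; rewrite -leqNgt -{2}(size_iota 0 m) count_size.
Qed.

(** Galois connection between partial sums and block indices: it turns the counting in [blk] into
    inequalities that [lia] can handle. *)
Lemma esum_le_blk d b i : (b <= size d)%N -> (esum d b <= i)%N = (b <= blk d i)%N.
Proof.
case: b => [|b] bd; first by rewrite /esum take0.
rewrite /blk (count_iota_prefix (P := fun j => (esum d j.+1 <= i)%N)) //.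
by move=> x y xy; apply: leq_trans; apply: esum_mono.
Qed.

Lemma blk_lt d i : (i < sumn d)%N -> (blk d i < size d)%N.
Proof. by move=> id; rewrite ltnNge -esum_le_blk // /esum take_size -ltnNge. Qed.

Lemma cblk_coarse a d (i : 'I_(sumn d)) : size d = (tr1 a + tr2 a + tr3 a)%N ->
  cblk a d i = coarse (fun i : 'I_(sumn d) => blk d i) (tr1 a) (tr2 a) i.
Proof. by move=> sd; rewrite /cblk /coarse !esum_le_blk ?sd //; lia. Qed.

Variable k : fieldType.

Lemma inQu_nilp a d (X : 'M[k]_(sumn d)) : size d = (tr1 a + tr2 a + tr3 a)%N ->
  inQu a X <-> block_nilp (fun i : 'I_(sumn d) => blk d i) (tr1 a) (tr2 a) X.
Proof. by move=> sd; split=> h i j; have := h i j; rewrite !cblk_coarse. Qed.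

Lemma same_orbitP d (X Y : 'M[k]_(sumn d)) :
  same_orbit X Y <-> upper_conj (fun i : 'I_(sumn d) => blk d i) Y X.
Proof.
split=> [[g [[gU ug] ->]]|[g [gU ug e]]]; exists g.
  by split=> //; rewrite mulmxKV.
by split=> //; rewrite e mulmxK.
Qed.

Definition dynkin a :=
  (tr1 a).+1%:R^-1 + (tr2 a)%:R^-1 + (tr3 a).+1%:R^-1 > 1 :> rat.

Lemma dynkin_finite a d : pos_triple a -> dimvec a d -> dynkin a -> finitely_many_orbits k a d.
Proof.
move=> [a1 [a2 a3]] [sd _] dyn.
have lev_lt (i : 'I_(sumn d)) : (blk d i < tr1 a + tr2 a + tr3 a)%N by rewrite -sd blk_lt.
have [s [sP sR]] := finite_conj k lev_lt a1 a2 dyn.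
exists s; split=> [Y /sP/(inQu_nilp _ sd)//|X /(inQu_nilp _ sd)/sR[Y Ys XY]].
by exists Y => //; apply/same_orbitP/upper_conj_sym.
Qed.

Lemma dynkin_le a c : pos_triple a -> le_triple a c -> dynkin c -> dynkin a.
Proof.
move=> [a1 [a2 a3]] [h1 [h2 h3]]; rewrite /dynkin => /lt_le_trans; apply.
by rewrite !lerD // lef_pV2 ?posrE ?ltr0n ?ler_nat //; apply: leq_trans h2.
Qed.

Lemma dynkin_rev a : dynkin (rev_triple a) <-> dynkin a.
Proof.
rewrite /dynkin /tr1 /tr2 /tr3 /=.
by rewrite addrC [X in _ < _ + X]addrC addrA.
Qed.

(** The infinite families are of type A or D: [(m, 1, l)] has an arm of length 1, the other two have
    two arms of length 2. The three sporadic triples all have arms of lengths 2, 3, 5, type E8, with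
    sum of reciprocals 31/30. *)
Lemma table2_dynkin c : in_table2 c -> dynkin c.
Proof.
have pos m : 0 < m.+1%:R^-1 :> rat by rewrite invr_gt0 ltr0n.
have half : 2%:R^-1 + 2%:R^-1 = 1 :> rat by [].
rewrite /dynkin; case=> [[m [_ ->]]|[[[|m] [h ->]]|[[m [l [_ [_ ->]]]]|[->|[->|->]]]]].
- by rewrite half ltrDl pos.
- by [].
- by rewrite addrAC half ltrDl pos.
- rewrite /tr1 /= invr1; have := pos m; have := pos l.
  by move: (_.+1%:R^-1) (_.+1%:R^-1) => x y; lra.
all: by rewrite /tr1 /tr2 /tr3 /=; lra.
Qed.
End Blocks.

(** * Separated families *)
Section Families.
Variable k : fieldType.

Definition separated_family a d (X : k -> 'M[k]_(sumn d)) :=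
  (forall x, inQu a (X x)) /\
  forall x y, upper_conj (fun i : 'I_(sumn d) => blk d i) (X x) (X y) -> x = y.

(** Not wildness in the sense of representation theory: only a family of pairwise non-conjugate
    elements indexed by [k]. *)
Definition wild a d := dimvec a d /\ exists X : k -> 'M[k]_(sumn d), separated_family a X.

(** * Extension of families by zero along an embedding of indices *)

Section Transfer.
Variables (d d' : seq nat) (s : 'I_(sumn d) -> 'I_(sumn d')).
Hypothesis s_inj : injective s.
Local Notation lev := (fun i : 'I_(sumn d) => blk d i).
Local Notation lev' := (fun i : 'I_(sumn d') => blk d' i).

Definition sel : 'M[k]_(sumn d', sumn d) := \matrix_(i', i) (s i == i')%:R.

Lemma selK : sel^T *m sel = 1%:M.
Proof.
apply/matrixP=> i j; rewrite !mxE (bigD1 (s i)) //= !mxE eqxx mul1r big1 ?addr0.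
  by rewrite (inj_eq s_inj) eq_sym.
by move=> i' si; rewrite !mxE eq_sym (negPf si) mul0r.
Qed.

Lemma selE (g : 'M[k]_(sumn d')) i j : (sel^T *m g *m sel) i j = g (s i) (s j).
Proof.
rewrite mxE (bigD1 (s j)) //= mxE [sel _ _]mxE eqxx mulr1 [X in _ + X]big1 ?addr0.
  rewrite (bigD1 (s i)) //= !mxE eqxx mul1r big1 ?addr0 // => l ls.
  by rewrite !mxE eq_sym (negPf ls) mul0r.
by move=> l ls; rewrite [sel _ _]mxE eq_sym (negPf ls) mulr0.
Qed.

Lemma pushE (X : 'M[k]_(sumn d)) i' j' : (sel *m X *m sel^T) i' j' != 0 ->
  exists i j, [/\ s i = i', s j = j' & X i j != 0].
Proof.
rewrite mxE => h; have [j] : exists j, (sel *m X) i' j * sel^T j j' != 0.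
  apply: NNPP => nj; case/eqP: h; apply: big1 => j _.
  by apply/eqP/negPn/negP => hj; apply: nj; exists j.
rewrite mulf_eq0 negb_or => /andP[h1]; rewrite !mxE => sj.
have ej : s j = j' by move: sj; case: (s j =P j') => //; rewrite eqxx.
move: h1; rewrite mxE => h1; have [i] : exists i, sel i' i * X i j != 0.
  apply: NNPP => nj; case/eqP: h1; apply: big1 => i _.
  by apply/eqP/negPn/negP => hi; apply: nj; exists i.
rewrite mulf_eq0 negb_or mxE => /andP[si Xij].
by exists i, j; split=> //; move: si; case: (s i =P i') => //; rewrite eqxx.
Qed.

Lemma compress_eq (g : 'M[k]_(sumn d')) (X Y : 'M[k]_(sumn d)) :
  g *m (sel *m X *m sel^T) = (sel *m Y *m sel^T) *m g ->
  (sel^T *m g *m sel) *m X = Y *m (sel^T *m g *m sel).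
Proof.
move=> e; have := congr1 (fun M => sel^T *m M *m sel) e.
by rewrite !mulmxA selK mul1mx -!mulmxA selK mulmx1 !mulmxA.
Qed.

Hypothesis s_lev : forall i j, (lev i < lev j)%N -> (lev' (s i) < lev' (s j))%N.
(** The image of [s] is a union of whole blocks; compressing an invertible matrix to a part of a
    block could make it singular. *)
Hypothesis s_full : forall i l, lev' l = lev' (s i) -> exists j, l = s j.

(* If [v] is a row killed by the compression and [m] is the least level in its support, then
   [v g] lives on levels above [m], hence so does [v = (v g) g^-1]. *)
Lemma compress_unit (g : 'M[k]_(sumn d')) : g \in unitmx -> upper lev' g ->
  sel^T *m g *m sel \in unitmx.
Proof.
move=> gU ug; rewrite unitmxE unitfE; apply/negP => /det0P[v v0 vg].
have [i0 vi0] : exists i, v 0 i != 0.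
  apply: NNPP => h; case/negP: v0; apply/eqP/rowP => i; rewrite mxE.
  by apply/eqP/negPn/negP => hi; apply: h; exists i.
have [i vi imin] := @arg_minnP _ i0 (fun i => v 0 i != 0) (fun i => lev' (s i)) vi0.
pose w := v *m sel^T *m g.
have w0 l : (lev' l <= lev' (s i))%N -> w 0 l = 0.
  move=> li; have [[j ->]|nj] := classic (exists j, l = s j).
    have <- : (w *m sel) 0 j = 0 by rewrite /w -(mulmxA v) -(mulmxA v) vg mxE.
    rewrite [RHS]mxE (bigD1 (s j)) //= [sel _ _]mxE eqxx mulr1 big1 ?addr0 // => l' ls.
    by rewrite [sel _ _]mxE eq_sym (negPf ls) mulr0.
  rewrite /w -mulmxA mxE big1 // => j _.
  have [->|vj] := eqVneq (v 0 j) 0; first by rewrite mul0r.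
  rewrite mxE big1 ?mulr0 // => l' _; rewrite !mxE.
  case: eqVneq => [<-|_]; last by rewrite mul0r.
  rewrite ug ?mulr0 // (leq_trans _ (imin j vj)) // ltn_neqAle li andbT.
  by apply/eqP=> e; apply: nj; apply: s_full e.
have ev : v = w *m invmx g *m sel by rewrite /w mulmxK // -mulmxA selK mulmx1.
case/negP: vi; rewrite ev mxE big1 // => l _; rewrite [sel _ _]mxE.
case: eqVneq => [<-|_]; last by rewrite mulr0.
rewrite mxE big1 ?mul0r // => l' _; have [/w0 ->|sl] := leqP (lev' l') (lev' (s i)).
  by rewrite mul0r.
by rewrite (upper_inv gU ug) ?mulr0.
Qed.

Lemma separated_push a a' (X : k -> 'M[k]_(sumn d)) :
  (forall i j : 'I_(sumn d), (cblk a d i < cblk a d j)%N ->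
    (cblk a' d' (s i) < cblk a' d' (s j))%N) ->
  separated_family a X -> separated_family a' (fun x => sel *m X x *m sel^T).
Proof.
move=> sc [XQ Xsep]; split=> [x i' j' ij|x y [g [gU ug e]]].
  apply/eqP/negPn/negP => /pushE[i [j [ei ej Xij]]]; case/negP: Xij; apply/eqP/XQ.
  by apply: contra ij; rewrite -ei -ej; apply: sc.
apply: Xsep; exists (sel^T *m g *m sel); split; last exact: compress_eq.
  exact: compress_unit.
by move=> i j /s_lev ij; rewrite selE ug.
Qed.

End Transfer.

(** * Families under transposition along the antidiagonal *)

Section Reversal.
Variables (d d' : seq nat) (s : 'I_(sumn d) -> 'I_(sumn d')).
Hypotheses (s_inj : injective s) (s_surj : forall l, exists i, s i = l).

Lemma selKV : sel s *m (sel s)^T = 1%:M.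
Proof.
apply/matrixP=> i' j'; have [[i <-] [j <-]] := (s_surj i', s_surj j').
rewrite !mxE (bigD1 i) //= !mxE eqxx mul1r big1 ?addr0; first by rewrite !(inj_eq s_inj).
by move=> l li; rewrite !mxE (inj_eq s_inj) (negPf li) mul0r.
Qed.

Lemma separated_rev a a' (X : k -> 'M[k]_(sumn d)) :
  (forall i j : 'I_(sumn d), (blk d i < blk d j)%N -> (blk d' (s j) < blk d' (s i))%N) ->
  (forall i j : 'I_(sumn d), (cblk a d i < cblk a d j)%N ->
    (cblk a' d' (s j) < cblk a' d' (s i))%N) ->
  separated_family a X -> separated_family a' (fun x => sel s *m (X x)^T *m (sel s)^T).
Proof.
move=> sl sc [XQ Xsep]; split=> [x i' j' ij|x y [g [gU ug /(compress_eq s_inj) e]]].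
  apply/eqP/negPn/negP => /pushE[i [j [ei ej]]]; rewrite mxE => Xij; case/negP: Xij; apply/eqP/XQ.
  by apply: contra ij; rewrite -ei -ej; apply: sc.
(* Transposing [h *m (X x)^T = (X y)^T *m h] exchanges the roles of [x] and [y], hence the
   [esym]. *)
apply/esym/Xsep; exists ((sel s)^T *m g *m sel s)^T; split.
- rewrite unitmx_tr; pose h := (sel s)^T *m invmx g *m sel s.
  have [] // := @mulmx1_unit _ _ ((sel s)^T *m g *m sel s) h.
  by rewrite !mulmxA -(mulmxA _ (sel s)) selKV mulmx1 mulmxK // selK.
- by move=> i j /sl ij; rewrite mxE selE ug.
move: e; move: ((sel s)^T *m g *m sel s) => h e.
by have := congr1 trmx e; rewrite !trmx_mul !trmxK.
Qed.
End Reversal.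

End Families.

(** * Insertion of a block and reversal *)
(** [esum_le_blk] gives access to block indices only through the comparisons [b <= blk d i], so
    equalities between them are proved by these tests. *)
Lemma eq_leq_tests N x y : (x <= N)%N -> (y <= N)%N ->
  (forall b, (b <= N)%N -> (b <= x)%N = (b <= y)%N) -> x = y.
Proof.
by move=> xN yN h; apply/eqP; rewrite eqn_leq -(h x xN) (h y yN) !leqnn.
Qed.

Lemma esum_full d b : (size d <= b)%N -> esum d b = sumn d.
Proof. by move=> h; rewrite /esum take_oversize. Qed.

Lemma esum_le_sumn d b : (esum d b <= sumn d)%N.
Proof.
rewrite -(esum_full (leqnn (size d))); have [h|h] := leqP b (size d); first exact: esum_mono.
by rewrite !esum_full // ltnW.
Qed.

Lemma cblkE a d i : size d = (tr1 a + tr2 a + tr3 a)%N ->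
  cblk a d i = ((tr1 a <= blk d i) + (tr1 a + tr2 a <= blk d i))%N.
Proof. by move=> sd; rewrite /cblk !esum_le_blk ?sd //; lia. Qed.

Section Insertion.
Variables (d : seq nat) (m : nat).
Hypothesis md : (m <= size d)%N.

(** With a block of size 1 a single index is skipped, so [bump] describes both the shift of indices
    and the shift of blocks. *)
Definition insert_block := take m d ++ 1%N :: drop m d.
Local Notation d' := insert_block.
Local Notation e := (esum d m).

Lemma size_insert : size d' = (size d).+1.
Proof. by rewrite size_cat /= size_takel // size_drop addnS subnKC. Qed.

Lemma sumn_insert : sumn d' = (sumn d).+1.
Proof. by rewrite sumn_cat /= addnCA -sumn_cat cat_take_drop. Qed.

Lemma esum_insert b : esum d' b = if (b <= m)%N then esum d b else (esum d b.-1).+1.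
Proof.
rewrite /esum take_cat size_takel //; case: ltngtP => [bm|mb|->].
- by rewrite take_takel // ltnW.
- case: b mb => // b; rewrite ltnS => mb; rewrite subSn //= sumn_cat /= addnCA add1n.
  by rewrite -sumn_cat -takeD subnKC.
by rewrite subnn cats0.
Qed.

Lemma blk_insert i : (i < sumn d)%N -> blk d' (bump e i) = bump m (blk d i).
Proof.
move=> id; have bd := blk_lt id.
have id' : (bump e i < sumn d')%N by rewrite sumn_insert /bump; lia.
apply: (@eq_leq_tests (size d').-1).
- by have := blk_lt id'; rewrite size_insert.
- by rewrite size_insert /bump /=; lia.
move=> b; rewrite size_insert /= => bs; rewrite -esum_le_blk ?size_insert 1?leqW //.
rewrite esum_insert /bump; have eb := esum_le_blk i md.
case: (leqP b m) => bm.
  by have := esum_mono d bm; have := esum_le_blk i bs; lia.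
have bs' : (b.-1 <= size d)%N by lia.
have mb : (m <= b.-1)%N by lia.
by have := esum_mono d mb; have := esum_le_blk i bs'; lia.
Qed.

Lemma blk_inserted : blk d' e = m.
Proof.
have mS : (m.+1 <= size d')%N by rewrite size_insert.
apply/eqP; rewrite eqn_leq leqNgt -!esum_le_blk ?esum_insert ?(leqW md) ?size_insert //;
  last exact: leqW.
by rewrite leqnn ltnn /= ltnn leqnn.
Qed.

Lemma insert_ord_subproof (i : 'I_(sumn d)) : (bump e i < sumn d')%N.
Proof. by rewrite sumn_insert /bump; have := ltn_ord i; lia. Qed.

Definition insert_ord i := Ordinal (insert_ord_subproof i).

End Insertion.

Lemma wild_insert (k : fieldType) a d a' m : wild k a d -> (m <= size d)%N ->
  (tr1 a' + tr2 a' + tr3 a' = (tr1 a + tr2 a + tr3 a).+1)%N ->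
  (forall b, (tr1 a' <= bump m b)%N = (tr1 a <= b)%N) ->
  (forall b, (tr1 a' + tr2 a' <= bump m b)%N = (tr1 a + tr2 a <= b)%N) ->
  wild k a' (insert_block d m).
Proof.
move=> [[sd dpos] [X sX]] md sa h1 h2; have sd' := size_insert md.
split; first split.
- by rewrite sd' sd sa.
- rewrite all_cat /= -[X in _ && X]andTb andTb; move: dpos; rewrite -{1}(cat_take_drop m d) all_cat.
  by case/andP=> -> ->.
have iE (i : 'I_(sumn d)) : blk (insert_block d m) (insert_ord md i) = bump m (blk d i).
  exact: blk_insert.
exists (fun x => sel k (insert_ord md) *m X x *m (sel k (insert_ord md))^T).
have inj : injective (insert_ord md).
  by move=> i j /(congr1 val)/= /(can_inj (@bumpK _))/val_inj.
apply: (separated_push inj _ _ _ sX).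
- by move=> i j; rewrite !iE /bump; lia.
- move=> i l; rewrite iE => el.
  have le : val l != esum d m.
    apply/eqP=> eq_l; have := blk_inserted md; rewrite -eq_l /= el => /eqP.
    by rewrite eq_sym (negPf (neq_bump _ _)).
  have lt : (unbump (esum d m) l < sumn d)%N.
    have ll : (l < (sumn d).+1)%N by rewrite -(sumn_insert d m) ltn_ord.
    by rewrite /unbump; have := esum_le_sumn d m; move: le => /eqP /=; lia.
  exists (Ordinal lt); apply: val_inj => /=; rewrite unbumpKcond; case: eqP => // eq_l.
  by case/eqP: le.
by move=> i j; rewrite !cblkE ?sd' ?sd ?sa // !iE !h1 !h2.
Qed.

(** The three entries are enlarged in turn, each time by inserting a block at the start of the group
    concerned: at position 0, at the new [a1], at the new [a1 + a2]. *)
Lemma wild_le (k : fieldType) c a d : wild k c d -> le_triple c a ->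
  exists d', wild k a d'.
Proof.
case: c a => [[c1 c2] c3] [[a1 a2] a3]; rewrite /le_triple /tr1 /tr2 /tr3 /=.
move=> w [/subnK <- [/subnK <- /subnK <-]].
have [d1 w1] : exists d', wild k ((a1 - c1 + c1)%N, c2, c3) d'.
  elim: (a1 - c1)%N => [|m [d' w']]; first by exists d.
  exists (insert_block d' 0); apply: (wild_insert w') => //; rewrite /tr1 /tr2 /tr3 /bump /=; lia.
have [d2 w2] : exists d', wild k ((a1 - c1 + c1)%N, (a2 - c2 + c2)%N, c3) d'.
  elim: (a2 - c2)%N => [|m [d' w']]; first by exists d1.
  exists (insert_block d' (a1 - c1 + c1)); have [[sd _] _] := w'.
  by apply: (wild_insert w'); rewrite ?sd /tr1 /tr2 /tr3 /bump /=; lia.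
elim: (a3 - c3)%N => [|m [d' w']]; first by exists d2.
exists (insert_block d' (a1 - c1 + c1 + (a2 - c2 + c2))); have [[sd _] _] := w'.
by apply: (wild_insert w'); rewrite ?sd /tr1 /tr2 /tr3 /bump /=; lia.
Qed.

Section Reverse.
Variable d : seq nat.
Local Notation n := (sumn d).

Lemma esum_rev b : (b <= size d)%N -> esum (rev d) b = (n - esum d (size d - b))%N.
Proof.
move=> bd; rewrite /esum take_rev sumn_rev.
have := sumn_cat (take (size d - b) d) (drop (size d - b) d).
by rewrite cat_take_drop => ->; rewrite addKn.
Qed.

Lemma blk_rev i : (i < n)%N -> blk (rev d) (n.-1 - i) = ((size d).-1 - blk d i)%N.
Proof.
move=> id; have bd := blk_lt id.
have id' : (n.-1 - i < sumn (rev d))%N by rewrite sumn_rev; lia.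
apply: (@eq_leq_tests (size d)).
- by have := blk_lt id'; rewrite size_rev => /ltnW.
- by lia.
move=> b bs; rewrite -esum_le_blk ?size_rev // esum_rev //.
have := esum_le_blk i (leq_subr b (size d)); have := esum_le_sumn d (size d - b); lia.
Qed.

Lemma rev_index_subproof (i : 'I_n) : (n.-1 - i < sumn (rev d))%N.
Proof. by rewrite sumn_rev; have := ltn_ord i; lia. Qed.

Definition rev_index i := Ordinal (rev_index_subproof i).
End Reverse.

Lemma wild_rev (k : fieldType) a d : wild k a d -> wild k (rev_triple a) (rev d).
Proof.
case: a => [[a0 a1] a2] [[sd dpos] [X sX]]; rewrite /tr1 /tr2 /tr3 /= in sd.
split; first by rewrite /dimvec /rev_triple size_rev all_rev sd /tr1 /tr2 /tr3 /=; split=> //; lia.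
exists (fun x => sel k (@rev_index d) *m (X x)^T *m (sel k (@rev_index d))^T).
have bE (i : 'I_(sumn d)) : blk (rev d) (rev_index i) = ((size d).-1 - blk d i)%N.
  exact: blk_rev.
have bl (i : 'I_(sumn d)) : (blk d i < size d)%N by apply: blk_lt.
apply: separated_rev sX.
- by move=> i j /(congr1 val)/= e; apply: val_inj => /=; have := ltn_ord i; have := ltn_ord j; lia.
- move=> l; have ll : (l < sumn d)%N by rewrite -[X in (_ < X)%N](sumn_rev d) ltn_ord.
  have h : ((sumn d).-1 - l < sumn d)%N by lia.
  by exists (Ordinal h); apply: val_inj => /=; lia.
- by move=> i j; rewrite !bE; have := bl i; have := bl j; lia.
move=> i j; rewrite /rev_triple !cblkE ?size_rev ?sd /tr1 /tr2 /tr3 /=; try lia.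
by rewrite !bE; have := bl i; have := bl j; lia.
Qed.

Lemma closed_field_new (k : closedFieldType) (L : seq k) : exists x, x \notin L.
Proof.
have /closed_nonrootP[x] : \prod_(z <- L) ('X - z%:P) != 0 :> {poly k}.
  by rewrite monic_neq0 // monic_prod_XsubC.
by rewrite root_prod_XsubC; exists x.
Qed.

(** Each representative is conjugate to at most one member of the family, so finitely many of them
    would confine the parameters to a finite list [L]. *)
Lemma wild_infinite (k : closedFieldType) a d : wild k a d -> ~ finitely_many_orbits k a d.
Proof.
move=> [_ [X [XQ Xsep]]] [s [_ sR]].
have [L LP] : exists L : seq k, forall x, (exists2 Y, Y \in s & same_orbit (X x) Y) -> x \in L.
  elim: s {sR} => [|Y s [L LP]]; first by exists [::] => x [].
  have [[x0 x0Y]|nY] := classic (exists x, same_orbit (X x) Y).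
    exists (x0 :: L) => x [Z]; rewrite !inE => /orP[/eqP ->|Zs] xZ.
      apply/orP; left; apply/eqP; apply: Xsep.
      move/same_orbitP: xZ => /upper_conj_sym xY; move/same_orbitP: x0Y => x0Y.
      exact: upper_conj_trans xY x0Y.
    by rewrite LP ?orbT //; exists Z.
  exists L => x [Z]; rewrite inE => /orP[/eqP ->|Zs] xZ; first by case: nY; exists x.
  by apply: LP; exists Z.
have [x /negP xL] := closed_field_new L; apply: xL; apply: LP.
exact: sR.
Qed.

(** * The critical families *)
Section Sparse.
Variable k : fieldType.
Implicit Types (L : seq (nat * nat * k)).

(** Natural-number indices let the critical families be treated with numerals, without membership
    proofs; entries out of range are 0. *)
Definition entry n (g : 'M[k]_n) (i j : nat) : k :=
  if (insub i, insub j) is (Some i', Some j') then g i' j' else 0.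

Definition sparse n L : 'M[k]_n :=
  \matrix_(i, j) \sum_(t <- L) (if (t.1.1 == i) && (t.1.2 == j) then t.2 else 0).

(** Entries of [g *m sparse n L], and in [row_eqn] of [sparse n L *m g], as fixpoints over the list:
    with numeral indices they simplify to sums of a few terms. *)
Fixpoint col_eqn (G : nat -> nat -> k) (i j : nat) L : k :=
  if L is t :: L' then (if eqn t.1.2 j then G i t.1.1 * t.2 else 0) + col_eqn G i j L' else 0.

Fixpoint row_eqn (G : nat -> nat -> k) (i j : nat) L : k :=
  if L is t :: L' then (if eqn t.1.1 i then t.2 * G t.1.2 j else 0) + row_eqn G i j L' else 0.

Lemma entryE n (g : 'M[k]_n) (i j : 'I_n) : entry g i j = g i j.
Proof. by rewrite /entry !valK. Qed.

Lemma sparse_eqn n (g : 'M[k]_n) L L' i j :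
  all (fun t => (t.1.1 < n) && (t.1.2 < n))%N L -> all (fun t => (t.1.1 < n) && (t.1.2 < n))%N L' ->
  g *m sparse n L = sparse n L' *m g -> (i < n)%N -> (j < n)%N ->
  col_eqn (entry g) i j L = row_eqn (entry g) i j L'.
Proof.
move=> Ln Ln' e i_n j_n; pose i' := Ordinal i_n; pose j' := Ordinal j_n.
have := congr1 (fun M : 'M_n => M i' j') e; rewrite !mxE.
have -> : \sum_l g i' l * sparse n L l j' = col_eqn (entry g) i j L.
  elim: L Ln {e} => [|t L IH] /=.
    by move=> _; apply: big1 => l _; rewrite mxE big_nil mulr0.
  case/andP=> /andP[t1 _] /IH <-; rewrite -[eqn _ _]/(t.1.2 == j).
  rewrite (eq_bigr (fun l : 'I_n => g i' l * (if (t.1.1 == l) && (t.1.2 == j) then t.2 else 0)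
      + g i' l * sparse n L l j')); last by move=> l _; rewrite !mxE big_cons mulrDr.
  rewrite big_split; congr (_ + _); case: (t.1.2 == j); last first.
    by apply: big1 => l _; rewrite andbF mulr0.
  rewrite (bigD1 (Ordinal t1)) //= eqxx big1 ?addr0; last first.
    by move=> l; rewrite -(inj_eq val_inj) /= eq_sym => /negPf ->; rewrite mulr0.
  by rewrite -[i]/(val i') -[t.1.1]/(val (Ordinal t1)) entryE.
move=> ->.
elim: L' Ln' {e} => [|t L' IH] /=.
  by move=> _; apply: big1 => l _; rewrite mxE big_nil mul0r.
case/andP=> /andP[_ t2] /IH <-; rewrite -[eqn _ _]/(t.1.1 == i).
rewrite (eq_bigr (fun l : 'I_n => (if (t.1.1 == i) && (t.1.2 == l) then t.2 else 0) * g l j'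
    + sparse n L' i' l * g l j')); last by move=> l _; rewrite !mxE big_cons mulrDl.
rewrite big_split; congr (_ + _); case: (t.1.1 == i); last first.
  by apply: big1 => l _; rewrite mul0r.
rewrite (bigD1 (Ordinal t2)) //= eqxx big1 ?addr0; last first.
  by move=> l; rewrite -(inj_eq val_inj) /= eq_sym => /negPf ->; rewrite mul0r.
by rewrite -[j]/(val j') -[t.1.2]/(val (Ordinal t2)) entryE.
Qed.

Lemma entry_upper d (g : 'M[k]_(sumn d)) i j :
  upper (fun i : 'I_(sumn d) => blk d i) g -> (blk d j < blk d i)%N -> entry g i j = 0.
Proof.
move=> ug ji; rewrite /entry; case: insubP => // i' _ ei; case: insubP => // j' _ ej.
by rewrite ug // -[nat_of_ord j']/(val j') -[nat_of_ord i']/(val i') ei ej.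
Qed.

Lemma entry_diag d (g : 'M[k]_(sumn d)) i :
  g \in unitmx -> upper (fun i : 'I_(sumn d) => blk d i) g -> (i < sumn d)%N ->
  all (fun j => (j == i) || (blk d j != blk d i)) (iota 0 (sumn d)) -> entry g i i != 0.
Proof.
move=> gU ug i_n /allP single; pose i' := Ordinal i_n; rewrite -[i]/(val i') entryE.
apply/eqP=> gi; have := congr1 (fun M : 'M_(sumn d) => M i' i') (mulmxV gU).
rewrite !mxE eqxx big1 => [/esym/eqP|j _]; first by rewrite oner_eq0.
have := single j; rewrite mem_iota ltn_ord => /(_ isT).
case: eqVneq => [/= ej|ji /=] h.
  by rewrite (_ : j = i') ?gi ?mul0r //; apply: val_inj.
have [ij|ji'] := ltnP (blk d j) (blk d i'); first by rewrite ug ?mul0r.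
by rewrite (upper_inv gU ug) ?mulr0 // ltn_neqAle eq_sym h.
Qed.

Lemma sparse_inQu a d L : all (fun t => cblk a d t.1.1 < cblk a d t.1.2)%N L ->
  inQu a (sparse (sumn d) L).
Proof.
move=> /allP h i j ij; rewrite mxE big_seq big1 // => t tL.
by case: andP => // -[/eqP ei /eqP ej]; case/negP: ij; rewrite -ei -ej h.
Qed.

Lemma lin_eq (a b c e : k) : c = e -> a - b = c - e -> a = b.
Proof. by move=> -> /eqP; rewrite subrr subr_eq0 => /eqP. Qed.

Lemma wild_sparse a d (L : k -> seq (nat * nat * k)) : dimvec a d ->
  (forall x, all (fun t => cblk a d t.1.1 < cblk a d t.1.2)%N (L x)) ->
  (forall x, all (fun t => (t.1.1 < sumn d) && (t.1.2 < sumn d))%N (L x)) ->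
  (forall x y (G : nat -> nat -> k),
    (forall i j, (blk d j < blk d i)%N -> G i j = 0) ->
    (forall i, (i < sumn d)%N ->
       all (fun j => (j == i) || (blk d j != blk d i)) (iota 0 (sumn d)) -> G i i != 0) ->
    (forall i j, (i < sumn d)%N -> (j < sumn d)%N -> col_eqn G i j (L x) = row_eqn G i j (L y)) ->
    x = y) -> wild k a d.
Proof.
move=> da LQ Ln Lsep; split=> //; exists (fun x => sparse (sumn d) (L x)); split=> [x|x y].
  exact: sparse_inQu.
move=> [g [gU ug e]]; apply: (Lsep x y (entry g)) => [i j|i|i j].
- exact: entry_upper.
- exact: entry_diag.
exact: sparse_eqn.
Qed.
End Sparse.

(** The term [U i j isT] typechecks only when the block comparison computes to true, so the second
    clause fires only on entries below the block diagonal. *)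
Ltac zap U := repeat match goal with
  | H : ?G ?i ?j = 0 |- context [?G ?i ?j] => rewrite H
  | |- context [?G ?i ?j] => rewrite (U i j isT)
  end.

(* Solves a goal [a = b] that is, up to sign and to entries known to vanish, the equation of
   index [(i, j)]. *)
Ltac entry_eq U E i j := let e := fresh in
  have := E i j isT isT; rewrite /=; zap U; move=> e;
  first [apply: (lin_eq e); zap U; ring | apply: (lin_eq (esym e)); zap U; ring].

Section Tables.
Variable k : fieldType.

(* The blocks put the three chains of the middle space in general position, and [x] is the one
   modulus of such a configuration. *)

Lemma wild_232 : wild k (2, 3, 2)%N [:: 1; 1; 1; 1; 1; 1; 1]%N.
Proof.
(* [W2] has dimension 3 and carries three complete flags. The rows of the upper block, [(0, 1, -1)]
   and [(1, x, -1-x)], have sum zero, so its kernel is spanned by [(1, 1, 1)]. *)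
apply: (@wild_sparse k _ _ (fun x => [:: ((0, 3)%N, 1); ((0, 4)%N, - 1); ((1, 2)%N, 1); ((1,
  3)%N, x); ((1, 4)%N, - (1 + x)); ((3, 6)%N, 1); ((4, 5)%N, 1)])) => //.
move=> x y G U N E.
have z2_4 : G 2 4 = 0 by entry_eq U E 2%N 5%N.
have z3_4 : G 3 4 = 0 by entry_eq U E 3%N 5%N.
have z2_3 : G 2 3 = 0 by entry_eq U E 2%N 6%N.
have z0_1 : G 0 1 = 0 by entry_eq U E 0%N 2%N.
have e3_3 : G 3 3 = G 0 0 by entry_eq U E 0%N 3%N.
have e4_4 : G 4 4 = G 0 0 by entry_eq U E 0%N 4%N.
have e1 : G 1 1 * x = G 0 0 * y by rewrite -e3_3; entry_eq U E 1%N 3%N.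
have e2 : G 1 1 * (1 + x) = G 0 0 * (1 + y) by rewrite -e4_4; entry_eq U E 1%N 4%N.
have e3 : G 1 1 = G 0 0 by move: e2; rewrite !mulrDr !mulr1 e1 => /addIr.
by apply: (mulfI (N 0%N isT isT)); rewrite -e1 e3.
Qed.

(** The flag of [W2] and the images of that of [W3] are opposite complete flags, whose common
    stabilizer is a torus. The columns [(1,0)], [(0,1)], [(1,1)], [(1,x)] of the upper block are
    then four points of a projective line, with [x] as cross-ratio. *)
Lemma wild_143 : wild k (1, 4, 3)%N [:: 2; 1; 1; 1; 1; 1; 1; 1]%N.
Proof.
apply: (@wild_sparse k _ _ (fun x => [:: ((0, 2)%N, 1); ((0, 4)%N, 1); ((0, 5)%N, 1); ((1, 3)%N,
  1); ((1, 4)%N, 1); ((1, 5)%N, x); ((3, 8)%N, 1); ((4, 7)%N, 1); ((5, 6)%N, 1)])) => //.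
move=> x y G U N E.
have z2_5 : G 2 5 = 0 by entry_eq U E 2%N 6%N.
have z3_5 : G 3 5 = 0 by entry_eq U E 3%N 6%N.
have z4_5 : G 4 5 = 0 by entry_eq U E 4%N 6%N.
have z2_4 : G 2 4 = 0 by entry_eq U E 2%N 7%N.
have z3_4 : G 3 4 = 0 by entry_eq U E 3%N 7%N.
have z2_3 : G 2 3 = 0 by entry_eq U E 2%N 8%N.
have e0_0 : G 0 0 = G 2 2 by entry_eq U E 0%N 2%N.
have z1_0 : G 1 0 = 0 by entry_eq U E 1%N 2%N.
have z0_1 : G 0 1 = 0 by entry_eq U E 0%N 3%N.
have e4_4 : G 4 4 = G 0 0 by entry_eq U E 0%N 4%N.
have e5_5 : G 5 5 = G 0 0 by entry_eq U E 0%N 5%N.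
have e1_1 : G 1 1 = G 4 4 by entry_eq U E 1%N 4%N.
have e : G 1 1 * x = G 5 5 * y by entry_eq U E 1%N 5%N.
by apply: (mulfI (N 2%N isT isT)); rewrite -e0_0 -{2}e5_5 -e e1_1 e4_4.
Qed.

Lemma wild_323 : wild k (3, 2, 3)%N [:: 1; 1; 1; 2; 2; 1; 1; 1]%N.
Proof.
(* The entries [-1] make the product of the upper and lower blocks a permutation matrix: the basis
   vectors 7, 8, 9 of [W3] go to 2, 1, 0 in [W1]. *)
apply: (@wild_sparse k _ _ (fun x => [:: ((0, 3)%N, 1); ((1, 3)%N, 1); ((1, 4)%N, x); ((1, 6)%N,
  1); ((2, 3)%N, 1); ((2, 4)%N, 1); ((2, 5)%N, 1); ((3, 9)%N, 1); ((5, 7)%N, 1); ((5, 9)%N, -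
  1); ((6, 8)%N, 1); ((6, 9)%N, - 1)])) => //.
move=> x y G U N E.
have z3_5 : G 3 5 = 0 by entry_eq U E 3%N 7%N.
have z4_5 : G 4 5 = 0 by entry_eq U E 4%N 7%N.
have z6_5 : G 6 5 = 0 by entry_eq U E 6%N 7%N.
have z3_6 : G 3 6 = 0 by entry_eq U E 3%N 8%N.
have z4_6 : G 4 6 = 0 by entry_eq U E 4%N 8%N.
have z4_3 : G 4 3 = 0 by entry_eq U E 4%N 9%N.
have z5_6 : G 5 6 = 0 by entry_eq U E 2%N 6%N.
have e2_2 : G 2 2 = G 3 3 by entry_eq U E 2%N 3%N.
have z1_2 : G 1 2 = 0 by entry_eq U E 1%N 5%N.
have z0_2 : G 0 2 = 0 by entry_eq U E 0%N 5%N.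
have z0_1 : G 0 1 = 0 by entry_eq U E 0%N 6%N.
have z3_4 : G 3 4 = 0 by entry_eq U E 0%N 4%N.
have e4_4 : G 4 4 = G 2 2 by entry_eq U E 2%N 4%N.
have e1_1 : G 1 1 = G 3 3 by entry_eq U E 1%N 3%N.
have e : G 1 1 * x = G 4 4 * y by entry_eq U E 1%N 4%N.
by apply: (mulfI (N 2%N isT isT)); rewrite -e4_4 -e e1_1 -e2_2 e4_4.
Qed.

Lemma wild_135 : wild k (1, 3, 5)%N [:: 3; 2; 2; 2; 1; 1; 1; 1; 1]%N.
Proof.
apply: (@wild_sparse k _ _ (fun x => [:: ((0, 4)%N, 1); ((0, 8)%N, 1); ((1, 3)%N, 1); ((1, 5)%N,
  1); ((1, 7)%N, 1); ((1, 8)%N, 1); ((2, 6)%N, 1); ((2, 7)%N, x); ((2, 8)%N, 1); ((4, 13)%N, 1);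
  ((5, 12)%N, 1); ((6, 11)%N, 1); ((7, 10)%N, 1); ((8, 9)%N, 1)])) => //.
move=> x y G U N E.
have z3_8 : G 3 8 = 0 by entry_eq U E 3%N 9%N.
have z4_8 : G 4 8 = 0 by entry_eq U E 4%N 9%N.
have z5_8 : G 5 8 = 0 by entry_eq U E 5%N 9%N.
have z6_8 : G 6 8 = 0 by entry_eq U E 6%N 9%N.
have z7_8 : G 7 8 = 0 by entry_eq U E 7%N 9%N.
have z3_7 : G 3 7 = 0 by entry_eq U E 3%N 10%N.
have z4_7 : G 4 7 = 0 by entry_eq U E 4%N 10%N.
have z5_7 : G 5 7 = 0 by entry_eq U E 5%N 10%N.
have z6_7 : G 6 7 = 0 by entry_eq U E 6%N 10%N.
have z3_6 : G 3 6 = 0 by entry_eq U E 3%N 11%N.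
have z4_6 : G 4 6 = 0 by entry_eq U E 4%N 11%N.
have z5_6 : G 5 6 = 0 by entry_eq U E 5%N 11%N.
have z3_5 : G 3 5 = 0 by entry_eq U E 3%N 12%N.
have z4_5 : G 4 5 = 0 by entry_eq U E 4%N 12%N.
have z3_4 : G 3 4 = 0 by entry_eq U E 3%N 13%N.
have z1_0 : G 1 0 = 0 by entry_eq U E 1%N 4%N.
have z2_0 : G 2 0 = 0 by entry_eq U E 2%N 4%N.
have z2_1 : G 2 1 = 0 by entry_eq U E 2%N 3%N.
have z0_2 : G 0 2 = 0 by entry_eq U E 0%N 6%N.
have z1_2 : G 1 2 = 0 by entry_eq U E 1%N 6%N.
have z0_1 : G 0 1 = 0 by entry_eq U E 0%N 5%N.
have e1_1_8 : G 1 1 = G 8 8 by entry_eq U E 1%N 8%N.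
have e2_2 : G 2 2 = G 8 8 by entry_eq U E 2%N 8%N.
have z8_7 : G 8 7 = 0 by entry_eq U E 0%N 7%N.
have e8_8 : G 8 8 = G 9 9 by entry_eq U E 8%N 9%N.
have e1_1 : G 1 1 = G 7 7 by entry_eq U E 1%N 7%N.
have e : G 2 2 * x = G 7 7 * y by entry_eq U E 2%N 7%N.
by apply: (mulfI (N 9%N isT isT)); rewrite -e8_8 -{1}e2_2 e -e1_1 e1_1_8.
Qed.

Lemma wild_162 : wild k (1, 6, 2)%N [:: 3; 1; 1; 1; 1; 1; 1; 2; 2]%N.
Proof.
apply: (@wild_sparse k _ _ (fun x => [:: ((0, 3)%N, 1); ((0, 7)%N, 1); ((1, 4)%N, 1); ((1, 6)%N,
  1); ((1, 7)%N, 1); ((1, 8)%N, 1); ((2, 5)%N, 1); ((2, 7)%N, 1); ((2, 8)%N, x); ((5, 11)%N, 1);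
  ((6, 12)%N, 1); ((7, 9)%N, 1); ((8, 10)%N, 1)])) => //.
move=> x y G U N E.
have z3_7 : G 3 7 = 0 by entry_eq U E 3%N 9%N.
have z4_7 : G 4 7 = 0 by entry_eq U E 4%N 9%N.
have z5_7 : G 5 7 = 0 by entry_eq U E 5%N 9%N.
have z6_7 : G 6 7 = 0 by entry_eq U E 6%N 9%N.
have z3_8 : G 3 8 = 0 by entry_eq U E 3%N 10%N.
have z4_8 : G 4 8 = 0 by entry_eq U E 4%N 10%N.
have z5_8 : G 5 8 = 0 by entry_eq U E 5%N 10%N.
have z6_8 : G 6 8 = 0 by entry_eq U E 6%N 10%N.
have z3_5 : G 3 5 = 0 by entry_eq U E 3%N 11%N.
have z4_5 : G 4 5 = 0 by entry_eq U E 4%N 11%N.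
have z3_6 : G 3 6 = 0 by entry_eq U E 3%N 12%N.
have z4_6 : G 4 6 = 0 by entry_eq U E 4%N 12%N.
have e0_0 : G 0 0 = G 3 3 by entry_eq U E 0%N 3%N.
have z1_0 : G 1 0 = 0 by entry_eq U E 1%N 3%N.
have z2_0 : G 2 0 = 0 by entry_eq U E 2%N 3%N.
have z2_1 : G 2 1 = 0 by entry_eq U E 2%N 4%N.
have z0_2 : G 0 2 = 0 by entry_eq U E 0%N 5%N.
have z1_2 : G 1 2 = 0 by entry_eq U E 1%N 5%N.
have z0_1 : G 0 1 = 0 by entry_eq U E 0%N 6%N.
have e7_7 : G 7 7 = G 0 0 by entry_eq U E 0%N 7%N.
have e1_1 : G 1 1 = G 7 7 by entry_eq U E 1%N 7%N.
have e2_2 : G 2 2 = G 7 7 by entry_eq U E 2%N 7%N.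
have z7_8 : G 7 8 = 0 by entry_eq U E 0%N 8%N.
have e8_8 : G 8 8 = G 1 1 by entry_eq U E 1%N 8%N.
have e : G 2 2 * x = G 8 8 * y by entry_eq U E 2%N 8%N.
by apply: (mulfI (N 3%N isT isT)); rewrite -e0_0 -e7_7 -{1}e2_2 e e8_8 e1_1.
Qed.

Lemma wild_225 : wild k (2, 2, 5)%N [:: 2; 2; 3; 3; 1; 1; 1; 1; 1]%N.
Proof.
(* The negative entries are chosen so that the product of the two blocks sends the basis vectors 10,
   11, 12, 13 of [W3] to 3, 2, 1, 0 and kills 14. *)
apply: (@wild_sparse k _ _ (fun x => [:: ((0, 6)%N, 1); ((1, 5)%N, 1); ((1, 7)%N, 1); ((2, 4)%N,
  1); ((2, 5)%N, 1); ((2, 6)%N, 1); ((2, 8)%N, 1); ((3, 5)%N, 1); ((3, 6)%N, x); ((3, 9)%N, 1);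
  ((5, 14)%N, 1); ((6, 13)%N, 1); ((7, 12)%N, 1); ((7, 14)%N, - 1); ((8, 11)%N, 1); ((8, 13)%N,
  - 1); ((8, 14)%N, - 1); ((9, 10)%N, 1); ((9, 13)%N, - x); ((9, 14)%N, - 1)])) => //.
move=> x y G U N E.
have z4_9 : G 4 9 = 0 by entry_eq U E 4%N 10%N.
have z5_9 : G 5 9 = 0 by entry_eq U E 5%N 10%N.
have z6_9 : G 6 9 = 0 by entry_eq U E 6%N 10%N.
have z7_9 : G 7 9 = 0 by entry_eq U E 7%N 10%N.
have z8_9 : G 8 9 = 0 by entry_eq U E 8%N 10%N.
have z4_8 : G 4 8 = 0 by entry_eq U E 4%N 11%N.
have z5_8 : G 5 8 = 0 by entry_eq U E 5%N 11%N.
have z6_8 : G 6 8 = 0 by entry_eq U E 6%N 11%N.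
have z7_8 : G 7 8 = 0 by entry_eq U E 7%N 11%N.
have z4_7 : G 4 7 = 0 by entry_eq U E 4%N 12%N.
have z5_7 : G 5 7 = 0 by entry_eq U E 5%N 12%N.
have z6_7 : G 6 7 = 0 by entry_eq U E 6%N 12%N.
have z4_6 : G 4 6 = 0 by entry_eq U E 4%N 13%N.
have z5_6 : G 5 6 = 0 by entry_eq U E 5%N 13%N.
have e6_6 : G 6 6 = G 13 13 by entry_eq U E 6%N 13%N.
have z4_5 : G 4 5 = 0 by entry_eq U E 4%N 14%N.
have z8_7 : G 8 7 = 0 by entry_eq U E 2%N 7%N.
have z2_3 : G 2 3 = 0 by entry_eq U E 2%N 9%N.
have z9_7 : G 9 7 = 0 by entry_eq U E 3%N 7%N.
have z0_2 : G 0 2 = 0 by entry_eq U E 0%N 8%N.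
have z0_3 : G 0 3 = 0 by entry_eq U E 0%N 9%N.
have z0_1 : G 0 1 = 0 by entry_eq U E 0%N 7%N.
have z6_4 : G 6 4 = 0 by entry_eq U E 0%N 4%N.
have z6_5 : G 6 5 = 0 by entry_eq U E 0%N 5%N.
have z1_2 : G 1 2 = 0 by entry_eq U E 1%N 8%N.
have z1_3 : G 1 3 = 0 by entry_eq U E 1%N 9%N.
have z5_4 : G 5 4 = 0 by entry_eq U E 1%N 4%N.
have z3_2 : G 3 2 = 0 by entry_eq U E 3%N 4%N.
have e2_2 : G 2 2 = G 5 5 by entry_eq U E 2%N 5%N.
have e2_2_6 : G 2 2 = G 6 6 by entry_eq U E 2%N 6%N.
have e3_3 : G 3 3 = G 5 5 by entry_eq U E 3%N 5%N.
have e : G 3 3 * x = G 6 6 * y by entry_eq U E 3%N 6%N.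
by apply: (mulfI (N 13%N isT isT)); rewrite -e6_6 -e e3_3 -e2_2 e2_2_6.
Qed.

End Tables.

(** * The dichotomy *)
Lemma table1_wild (k : fieldType) a d : (a, d) \in table1 -> wild k a d.
Proof.
rewrite !inE => /orP[|/orP[|/orP[|/orP[|/orP[|]]]]] /eqP[-> ->].
- exact: wild_135.
- exact: wild_143.
- exact: wild_162.
- exact: wild_225.
- exact: wild_232.
exact: wild_323.
Qed.

Lemma in_table2_pos c : in_table2 c -> pos_triple c.
Proof. by case=> [[m [h ->]]|[[m [h ->]]|[[m [l [h [h' ->]]]]|[->|[->|->]]]]]. Qed.

(** Both alternatives are invariant under reversal, so the case tree only looks at [y] and at the
    minimum and maximum of [x] and [z]. *)
Lemma triple_dichotomy a : pos_triple a ->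
  (exists c, in_table2 c /\ (le_triple a c \/ le_triple a (rev_triple c))) \/
  (exists c d0, (c, d0) \in table1 /\ (le_triple c a \/ le_triple (rev_triple c) a)).
Proof.
case: a => [[x y] z] [/= x0 [y0 z0]]; rewrite /tr1 /tr2 /tr3 /= in x0 y0 z0.
set P := (_ \/ _).
have small c : in_table2 c -> le_triple (x, y, z) c \/ le_triple (x, y, z) (rev_triple c) -> P.
  by move=> c2 h; left; exists c.
(* The number [i] is the row of [table1], counted from 0; the calls below name the critical pair in
   this way. *)
have big i : (i < size table1)%N -> let c := (nth ((0, 0, 0), [::])%N table1 i).1 in
    le_triple c (x, y, z) \/ le_triple (rev_triple c) (x, y, z) -> P.
  move=> i6 c h; right; exists c, (nth ((0, 0, 0), [::])%N table1 i).2; split=> //.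
  by rewrite -surjective_pairing mem_nth.
have t2_12m m : (0 < m)%N -> in_table2 (1, 2, m)%N by left; exists m.
have t2_1m1 m : (0 < m)%N -> in_table2 (1, m, 1)%N by right; left; exists m.
have t2_m1l m l : (0 < m)%N -> (0 < l)%N -> in_table2 (m, 1, l)%N.
  by right; right; left; exists m, l.
have t2_134 : in_table2 (1, 3, 4)%N by right; right; right; left.
have t2_152 : in_table2 (1, 5, 2)%N by right; right; right; right; left.
have t2_224 : in_table2 (2, 2, 4)%N by right; right; right; right; right.
move: small big; clearbody P; rewrite /le_triple /rev_triple /tr1 /tr2 /tr3 /= => small big.
have [y1|y2] := leqP y 1; first by apply: (small _ (t2_m1l x z x0 z0)) => /=; lia.
have [xz|xz] := leqP (minn x z) 1.
  have [zx|zx] := leqP (maxn x z) 1; first by apply: (small _ (t2_1m1 y y0)) => /=; lia.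
  have [y2'|y3] := leqP y 2; first by apply: (small _ (t2_12m (maxn x z) _)) => /=; lia.
  have [z2|z3] := leqP (maxn x z) 2.
    have [y5|y6] := leqP y 5; first by apply: (small _ t2_152) => /=; lia.
    by apply: (big 2%N) => //=; lia.
  have [z4|z5] := leqP (maxn x z) 4; last by apply: (big 0%N) => //=; lia.
  have [y3'|y4] := leqP y 3; first by apply: (small _ t2_134) => /=; lia.
  by apply: (big 1%N) => //=; lia.
have [y2'|y3] := leqP y 2; last by apply: (big 4%N) => //=; lia.
have [z2|z3] := leqP (minn x z) 2; last by apply: (big 5%N) => //=; lia.
have [z4|z5] := leqP (maxn x z) 4; first by apply: (small _ t2_224) => /=; lia.
by apply: (big 3%N) => //=; lia.
Qed.

Theorem theorem1p1 (k : closedFieldType) :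
  (* (1) Table 1: infinitely many orbits *)
  (forall a d, (a, d) \in table1 -> ~ finitely_many_orbits k a d) /\
  (* (2) Table 2: finitely many orbits for every dimension vector *)
  (forall a, in_table2 a -> forall d, dimvec a d -> finitely_many_orbits k a d) /\
  (* (3) dichotomy and its consequences *)
  (forall a, pos_triple a ->
     ((exists c, in_table2 c /\ (le_triple a c \/ le_triple a (rev_triple c))) \/
      (exists c d0, (c, d0) \in table1 /\ (le_triple c a \/ le_triple (rev_triple c) a))) /\
     ((exists c, in_table2 c /\ (le_triple a c \/ le_triple a (rev_triple c))) ->
        forall d, dimvec a d -> finitely_many_orbits k a d) /\
     ((exists c d0, (c, d0) \in table1 /\ (le_triple c a \/ le_triple (rev_triple c) a)) ->
        exists d, dimvec a d /\ ~ finitely_many_orbits k a d)).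
Proof.
split; [|split].
- by move=> a d /(table1_wild k)/wild_infinite.
- move=> a a2 d da.
  exact: dynkin_finite (in_table2_pos a2) da (table2_dynkin a2).
move=> a pa; split; [exact: triple_dichotomy|split].
  move=> [c [c2 ac]] d da; apply: dynkin_finite => //.
  case: ac => ac; apply: dynkin_le ac _ => //; first exact: table2_dynkin.
  exact/dynkin_rev/table2_dynkin.
move=> [c [d0 [/(table1_wild k) w ca]]].
have [d wd] : exists d, wild k a d.
  by case: ca => ca; [apply: wild_le w ca|apply: wild_le (wild_rev w) ca].
by exists d; split; [case: wd|apply: wild_infinite].
Qed.
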